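(* Let $H$ be a (full) Hopf algebroid with bijective antipode $S$, with left bialgebroid $H^\ell$ over $A$ and right bialgebroid $H^r$ over $B$, such that ${}_{\triangleright}H$ and $H_{\triangleleft}$ are finitely generated projective $A$-modules. Regard $(H^r)^{\rm op}_{\rm coop}$ as a left bialgebroid over $A$ by means of the isomorphism $\nu=\partial s^\ell:A\to B^{\rm op}$. Let $S^*_\ell:(H^\ell)^*\to(H^\ell)_*$ and $S^*_r:\big((H^r)^{\rm op}_{\rm coop}\big)^*\to\big((H^r)^{\rm op}_{\rm coop}\big)_*$ be the maps $S^*$ associated with the left Hopf algebroids $H^\ell$ and $(H^r)^{\rm op}_{\rm coop}$, and let $${}^{t}S:\big((H^r)^{\rm op}_{\rm coop}\big)^*\to(H^\ell)^*,\qquad {}^{t}S:\big((H^r)^{\rm op}_{\rm coop}\big)_*\to(H^\ell)_*$$ be given by $\phi\mapsto\phi\circ S$. Then these four maps are morphisms of right bialgebroids and $$S^*_\ell\circ{}^{t}S={}^{t}S\circ S^*_r:\ \big((H^r)^{\rm op}_{\rm coop}\big)^*\to(H^\ell)_*.$$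
   Context: $k$ is a commutative ring, unadorned $\otimes$ is over $k$, $A,B$ are associative unital $k$-algebras, $A^e=A\otimes A^{\rm op}$. An $A^e$-ring $U$ is a $k$-algebra with a $k$-algebra map $\eta:A^e\to U$; put $s^\ell(a)=\eta(a\otimes1)$ (source), $t^\ell(a)=\eta(1\otimes a)$ (target). Write $$a\triangleright u\triangleleft b:=s^\ell(a)t^\ell(b)u,\qquad a\blacktriangleright u\blacktriangleleft b:=u\,t^\ell(a)s^\ell(b),$$ and ${}_{\triangleright}U,\ U_{\triangleleft},\ {}_{\blacktriangleright}U,\ U_{\blacktriangleleft}$ for $U$ with the corresponding $A$-action. Thus in $U_{\triangleleft}\otimes_A{}_{\triangleright}U$ one has $t^\ell(a)u\otimes u'=u\otimes s^\ell(a)u'$. Its Takeuchi product $U_{\triangleleft}\times_A{}_{\triangleright}U$ consists of the $\sum_i u_i\otimes u_i'$ with $\sum_i u_it^\ell(a)\otimes u_i'=\sum_i u_i\otimes u_i's^\ell(a)$ for all $a\in A$; it is an algebra under factorwise multiplication. A left bialgebroid $(U,A)$ is an $A^e$-ring $U$ with an $A$-coring structure (coassociative coproduct $\Delta_\ell:U\to U_{\triangleleft}\otimes_A{}_{\triangleright}U$, $u\mapsto u_{(1)}\otimes_A u_{(2)}$, and counit $\epsilon:U\to A$, both bimodule maps for ${}_{\triangleright}U_{\triangleleft}$) such that $\Delta_\ell$ is a unital $k$-algebra map into $U_{\triangleleft}\times_A{}_{\triangleright}U$, and $\epsilon(1)=1$, $\epsilon(uu')=\epsilon(u\,s^\ell(\epsilon(u')))=\epsilon(u\,t^\ell(\epsilon(u')))$.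 A right bialgebroid $(V,B,s^r,t^r,\Delta_r,\partial)$ is a datum such that $(V^{\rm op},B,t^r,s^r,\Delta_r,\partial)$ (source $t^r$, target $s^r$) is a left bialgebroid; thus $\Delta_r:V\to V_{\blacktriangleleft}\otimes_B{}_{\blacktriangleright}V$, $v\mapsto v^{(1)}\otimes_Bv^{(2)}$, with $v\,s^r(b)\otimes v'=v\otimes v'\,t^r(b)$. Morphisms of bialgebroids are pairs of algebra maps (on total and base algebras) commuting with source, target, coproduct and counit; here the base map is $\mathrm{id}_A$. $U$ is a left Hopf algebroid if $\alpha_\ell:{}_{\blacktriangleright}U\otimes_{A^{\rm op}}U_{\triangleleft}\to U_{\triangleleft}\otimes_A{}_{\triangleright}U$, $u\otimes v\mapsto u_{(1)}\otimes u_{(2)}v$ (with $ut^\ell(a)\otimes v=u\otimes t^\ell(a)v$ in the domain) is bijective; then $u_+\otimes_{A^{\rm op}}u_-:=\alpha_\ell^{-1}(u\otimes_A1)$. Duals of a left bialgebroid $U$: $U^*:=\mathrm{Hom}_{A^{\rm op}}(U_{\triangleleft},A)$ (maps with $\phi(t^\ell(a)u)=\phi(u)a$) and $U_*:=\mathrm{Hom}_A({}_{\triangleright}U,A)$ (maps with $\psi(s^\ell(a)u)=a\psi(u)$), both with unit $\epsilon$. If $U_{\triangleleft}$ is finitely generated projective, $U^*$ is a right bialgebroid over $A$: $(\phi\phi')(u)=\phi'(s^\ell(\phi(u_{(1)}))u_{(2)})$, source $a\mapsto\epsilon(-\,s^\ell(a))$, target $a\mapsto a\,\epsilon(-)$,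 counit $\phi\mapsto\phi(1)$, coproduct determined by $\phi(uu')=\phi^{(1)}(u\,t^\ell(\phi^{(2)}(u')))$. If ${}_{\triangleright}U$ is finitely generated projective, $U_*$ is a right bialgebroid over $A$: $(\psi\psi')(u)=\psi'(t^\ell(\psi(u_{(2)}))u_{(1)})$, source $a\mapsto\epsilon(-)a$, target $a\mapsto\epsilon(-\,t^\ell(a))$, counit $\psi\mapsto\psi(1)$, coproduct determined by $\psi(uu')=\psi^{(2)}(u\,s^\ell(\psi^{(1)}(u')))$. For a left Hopf algebroid $U$, $S^*:U^*\to U_*$ is defined by $S^*(\phi)(u)=\epsilon(u_+\,t^\ell(\phi(u_-)))$. A (full) Hopf algebroid is a $k$-algebra $H$ with a left bialgebroid structure $H^\ell=(H,A,s^\ell,t^\ell,\Delta_\ell,\epsilon)$, a right bialgebroid structure $H^r=(H,B,s^r,t^r,\Delta_r,\partial)$ on the same algebra $H$, and a $k$-linear map $S:H\to H$ (antipode) such that: (1) $s^\ell\epsilon t^r=t^r$, $t^\ell\epsilon s^r=s^r$, $s^r\partial t^\ell=t^\ell$, $t^r\partial s^\ell=s^\ell$; (2) $(\Delta_\ell\otimes_B\mathrm{id})\Delta_r=(\mathrm{id}\otimes_A\Delta_r)\Delta_\ell$ and $(\Delta_r\otimes_A\mathrm{id})\Delta_\ell=(\mathrm{id}\otimes_B\Delta_\ell)\Delta_r$; (3) $S(t^\ell(a)\,h\,t^r(b))=s^r(b)S(h)s^\ell(a)$; (4) $S(h_{(1)})h_{(2)}=s^r(\partial(h))$ and $h^{(1)}S(h^{(2)})=s^\ell(\epsilon(h))$.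 The map $\nu=\partial s^\ell:A\to B^{\rm op}$ is an algebra isomorphism, and $(H^r)^{\rm op}_{\rm coop}$, viewed over $A$ via $\nu$, is the left bialgebroid $(H^{\rm op},A,s^r\nu,t^r\nu,\Delta_r^{\rm coop},\nu^{-1}\partial)$; $(S,\mathrm{id}_A):H^\ell\to(H^r)^{\rm op}_{\rm coop}$ is a morphism of left bialgebroids, and both are left Hopf algebroids. *)

(* Defs.v *)
From HB Require Import structures.
From mathcomp Require Import all_boot all_algebra.
From mathcomp Require Import boolp classical_sets.
From mathcomp Require Import freeg.

Set Implicit Arguments.
Unset Strict Implicit.
Unset Printing Implicit Defensive.

Import GRing.Theory.
Local Open Scope ring_scope.
Local Open Scope quotient_scope.

(* Associative unital k-algebras, as rings with a ring map from k into their
   center.  The library's algType is not used because it requires 1 != 0. *)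
HB.mixin Record isKAlgebra (k : comPzRingType) A of GRing.PzRing A := {
  scal : {rmorphism k -> A};
  scalC_subproof : forall (c : k) (x : A), scal c * x = x * scal c
}.
#[short(type="kalgType")]
HB.structure Definition KAlgebra (k : comPzRingType) :=
  {A of GRing.PzRing A & isKAlgebra k A}.

Arguments scal {k A} : rename.
Lemma scalC (k : comPzRingType) (A : kalgType k) (c : k) (x : A) :
  scal c * x = x * scal c.
Proof. exact: scalC_subproof. Qed.

Section Converse.
Variables (k : comPzRingType) (A : kalgType k).
Definition scalc (c : k) : A^c := scal c.
Lemma scalc_zmod : zmod_morphism scalc.
Proof. by move=> x y; apply: (raddfB (@scal k A)). Qed.
Lemma scalc_monoid : monoid_morphism scalc.
Proof. by split; [exact: (rmorph1 (@scal k A)) | move=> x y; rewrite mulrC; apply: (rmorphM (@scal k A))]. Qed.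
HB.instance Definition _ := GRing.isZmodMorphism.Build k A^c scalc scalc_zmod.
HB.instance Definition _ := GRing.isMonoidMorphism.Build k A^c scalc scalc_monoid.
HB.instance Definition _ := isKAlgebra.Build k A^c
  (scal := scalc) (fun c (x : A) => esym (@scalC k A c x)).
End Converse.

Definition kalg_morphism (k : comPzRingType) (A B : kalgType k) (f : A -> B) :=
  [/\ zmod_morphism f, monoid_morphism f & forall c : k, f (scal c) = scal c].

(* The abelian group with generators X and relators rel. *)
Section Presentation.
Variables (X : choiceType) (rel : {freeg X} -> Prop).

Definition relators : {pred {freeg X}} := fun d =>
  `[< forall S : {freeg X} -> Prop,
        S 0 -> (forall x y, S x -> S y -> S (x - y)) ->
        (forall x, rel x -> S x) -> S d >].

Lemma relators_zmod_closed : zmod_closed relators.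
Proof.
split; first by rewrite unfold_in; apply/asboolP => S S0 _ _; exact: S0.
move=> x y; rewrite !unfold_in => /asboolP Sx /asboolP Sy.
apply/asboolP => S S0 SB Sr.
exact: (SB _ _ (Sx _ S0 SB Sr) (Sy _ S0 SB Sr)).
Qed.
HB.instance Definition _ :=
  GRing.isZmodClosed.Build {freeg X} relators relators_zmod_closed.

Local Notation Q := (@Quotient.quot {freeg X} relators).
Definition presented : Type := Q.
HB.instance Definition _ := GRing.Zmodule.on presented.
Definition pgen (x : X) : presented :=
  \pi_Q (<< x >> : {freeg X}).

(* The extension to the presented group of a function f on the generators,
   computed on a representative: an additive map with plift f (pgen x) = f x as
   soon as f is compatible with the relators. *)
Definition plift (G : zmodType) (f : X -> G) (x : presented) : G :=
  fglift (f : X -> zmodule G) (repr (x : Q)).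

Lemma fgliftD (G : zmodType) (f : X -> G) x y :
  fglift (f : X -> zmodule G) (x + y) =
  fglift (f : X -> zmodule G) x + fglift (f : X -> zmodule G) y.
Proof.
pose F : {freeg X} -> G := fglift (f : X -> zmodule G).
have FB : zmod_morphism F.
  by move=> a b; exact: (lift_is_additive (f : X -> zmodule G)).
have F0 : F 0 = 0 by have := FB 0 0; rewrite !subrr.
have FN z : F (- z) = - F z by rewrite -[- z]sub0r FB F0 sub0r.
by rewrite -[y]opprK; change (F (x - - y) = F x + F (- - y)); rewrite FB !FN.
Qed.

Lemma pi_rel d : rel d -> \pi_Q d = 0.
Proof.
move=> rd; apply/eqP; rewrite -[0](raddf0 (\pi_Q)) -Quotient.idealrBE subr0.
by rewrite unfold_in; apply/asboolP => S _ _; apply.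
Qed.

Lemma pi_relB d e : rel (d - e) -> \pi_Q d = \pi_Q e.
Proof. by move/pi_rel; rewrite raddfB => /eqP; rewrite subr_eq0 => /eqP. Qed.

Lemma pi_genD d x y : rel (d - (<< x >> + << y >>)) ->
  \pi_Q d = pgen x + pgen y :> presented.
Proof. by move/pi_relB ->; rewrite raddfD. Qed.

Definition respects (G : zmodType) (f : X -> G) :=
  forall d, rel d -> fglift (f : X -> zmodule G) d = 0.

Lemma plift_pi (G : zmodType) (f : X -> G) : respects f ->
  forall d, plift f (\pi_Q d) = fglift (f : X -> zmodule G) d.
Proof.
move=> rf d; rewrite /plift; set d' := repr _.
have /eqP: d' = d %[mod Q] by rewrite reprK.
rewrite -Quotient.idealrBE => /asboolP H.
have f0 : fglift (f : X -> zmodule G) (0 : {freeg X}) = 0.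
  have := lift_is_additive (f : X -> zmodule G) 0 0.
  by rewrite !subrr.
have fB (x y : {freeg X}) : fglift (f : X -> zmodule G) x = 0 ->
    fglift (f : X -> zmodule G) y = 0 -> fglift (f : X -> zmodule G) (x - y) = 0.
  by move=> hx hy; rewrite lift_is_additive hx hy subrr.
have := H (fun d => fglift (f : X -> zmodule G) d = 0) f0 fB rf.
by rewrite lift_is_additive => /eqP; rewrite subr_eq0 => /eqP.
Qed.

Lemma plift_gen (G : zmodType) (f : X -> G) :
  respects f -> forall x, plift f (pgen x) = f x.
Proof. by move=> rf x; rewrite plift_pi // liftU scale1r. Qed.

Lemma plift_additive (G : zmodType) (f : X -> G) :
  respects f -> zmod_morphism (plift f).
Proof.
move=> rf; elim/quotW => x; elim/quotW => y.
by rewrite -[_ - _](raddfB (\pi_Q)) !plift_pi ?lift_is_additive.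
Qed.

Lemma presented_ind (P : presented -> Prop) :
  P 0 -> (forall x y, P x -> P y -> P (x - y)) -> (forall x, P (pgen x)) ->
  forall x, P x.
Proof.
move=> P0 PB Pg; elim/quotW => d.
have PN x : P x -> P (- x) by move=> Px; rewrite -sub0r; exact: PB.
have PD x y : P x -> P y -> P (x + y).
  by move=> Px Py; rewrite -[y]opprK; apply: PB => //; exact: PN.
have PM x n : P x -> P (x *+ n).
  by move=> Px; elim: n => [|n IH]; rewrite ?mulr0n // mulrS; exact: PD.
have PZ x (n : int) : P x -> P (x *~ n).
  by move=> Px; case: n => n; [exact: PM | apply: PN; exact: PM].
rewrite -(freeg_sumE d); pose pi := \pi_Q.
rewrite (raddf_sum pi); apply: (big_ind P) => // x _.
have -> : << coeff x d *g x >> = (<< x >> : {freeg X}) *~ coeff x d.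
  by rewrite freegU_mulz intz.
by rewrite (raddfMz pi); apply: PZ; exact: Pg.
Qed.
End Presentation.

(* M (x) N / (ract i m (x) n = m (x) lact i n), as an abelian group. *)
Section Tensor.
Variables (I : Type) (M N : zmodType) (ract : I -> M -> M) (lact : I -> N -> N).

Inductive tensor_rel : {freeg (M * N)%type} -> Prop :=
| tensor_addl m m' n : tensor_rel (<< (m + m', n) >> - (<< (m, n) >> + << (m', n) >>))
| tensor_addr m n n' : tensor_rel (<< (m, n + n') >> - (<< (m, n) >> + << (m, n') >>))
| tensor_bal i m n : tensor_rel (<< (ract i m, n) >> - << (m, lact i n) >>).

Definition tensor : Type := presented tensor_rel.
HB.instance Definition _ := GRing.Zmodule.on tensor.
Definition tens (m : M) (n : N) : tensor := pgen tensor_rel (m, n).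

Definition balanced (G : zmodType) (f : M -> N -> G) :=
  [/\ forall m m' n, f (m + m') n = f m n + f m' n,
      forall m n n', f m (n + n') = f m n + f m n' &
      forall i m n, f (ract i m) n = f m (lact i n)].

(* The map induced on the tensor product by f; it depends on the chosen
   representative of x unless f is balanced. *)
Definition tlift (G : zmodType) (f : M -> N -> G) (x : tensor) : G :=
  plift (fun p => f p.1 p.2) x.

Lemma balanced_respects (G : zmodType) (f : M -> N -> G) :
  balanced f -> respects tensor_rel (fun p => f p.1 p.2).
Proof.
case=> fDl fDr fb d [m m' n|m n n'|i m n];
  by rewrite lift_is_additive ?fgliftD !liftU !scale1r /= ?fDl ?fDr ?fb subrr.
Qed.

Lemma tlift_tens (G : zmodType) (f : M -> N -> G) : balanced f ->
  forall m n, tlift f (tens m n) = f m n.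
Proof. by move=> /balanced_respects rf m n; rewrite /tlift plift_gen. Qed.

Lemma tlift_additive (G : zmodType) (f : M -> N -> G) : balanced f ->
  zmod_morphism (tlift f).
Proof. by move=> /balanced_respects /plift_additive. Qed.

Lemma tensor_ext (G : zmodType) (f g : tensor -> G) :
  zmod_morphism f -> zmod_morphism g ->
  (forall m n, f (tens m n) = g (tens m n)) -> f =1 g.
Proof.
move=> fB gB fg; apply: (presented_ind (rel := tensor_rel)).
- by have := fB 0 0; have := gB 0 0; rewrite !subrr => -> ->.
- by move=> x y hx hy; rewrite fB gB hx hy.
- by case=> m n; exact: fg.
Qed.

Lemma tens_balanced : balanced tens.
Proof.
split=> [m m' n|m n n'|i m n].
- exact: pi_genD (tensor_addl m m' n).
- exact: pi_genD (tensor_addr m n n').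
- exact: pi_relB (tensor_bal i m n).
Qed.

Lemma tensDl m m' n : tens (m + m') n = tens m n + tens m' n.
Proof. by have [-> _ _] := tens_balanced. Qed.
Lemma tensDr m n n' : tens m (n + n') = tens m n + tens m n'.
Proof. by have [_ -> _] := tens_balanced. Qed.
Lemma tens_bal i m n : tens (ract i m) n = tens m (lact i n).
Proof. by have [_ _ ->] := tens_balanced. Qed.

Lemma eq_tlift (G : zmodType) (f g : M -> N -> G) x :
  (forall m n, f m n = g m n) -> tlift f x = tlift g x.
Proof. by move=> fg; congr tlift; apply/funext => m; apply/funext => n. Qed.

Lemma zmod_morphism0 (G G' : zmodType) (F : G -> G') : zmod_morphism F -> F 0 = 0.
Proof. by move=> FB; have := FB 0 0; rewrite !subrr. Qed.

Lemma zmod_morphismN (G G' : zmodType) (F : G -> G') : zmod_morphism F ->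
  forall x, F (- x) = - F x.
Proof. by move=> FB x; rewrite -[- x]sub0r FB (zmod_morphism0 FB) sub0r. Qed.

Lemma zmod_morphismD (G G' : zmodType) (F : G -> G') : zmod_morphism F ->
  forall x y, F (x + y) = F x + F y.
Proof. by move=> FB x y; rewrite -{1}[y]opprK FB (zmod_morphismN FB) opprK. Qed.

Lemma raddf_tlift (G G' : zmodType) (F : G -> G') (f : M -> N -> G) x :
  zmod_morphism F -> balanced f -> F (tlift f x) = tlift (fun m n => F (f m n)) x.
Proof.
move=> FB fb; have [fDl fDr fi] := fb; have FD := zmod_morphismD FB.
have Ffb : balanced (fun m n => F (f m n)).
  by split=> *; rewrite ?fDl ?fDr ?fi ?FD.
move: x; apply: tensor_ext => [x y|x y|m n].
- by rewrite tlift_additive ?FB.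
- by rewrite tlift_additive.
- by rewrite !tlift_tens.
Qed.

Lemma tliftD (G : zmodType) (f : M -> N -> G) x y : balanced f ->
  tlift f (x + y) = tlift f x + tlift f y.
Proof. by move=> fb; apply: zmod_morphismD (tlift_additive fb) _ _. Qed.

Lemma tliftDf (G : zmodType) (f g : M -> N -> G) x : balanced f -> balanced g ->
  tlift (fun m n => f m n + g m n) x = tlift f x + tlift g x.
Proof.
move=> fb gb; have [f1 f2 f3] := fb; have [g1 g2 g3] := gb.
have fgb : balanced (fun m n => f m n + g m n).
  by split=> *; rewrite ?(f1, f2, f3) ?(g1, g2, g3) // addrACA.
move: x; apply: tensor_ext => [x y|x y|m n].
- exact: tlift_additive.
- by rewrite !tlift_additive // opprD addrACA.
- by rewrite !tlift_tens.
Qed.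

Lemma tlift_id x : tlift tens x = x.
Proof.
move: x; apply: tensor_ext => // m n; first exact: tlift_additive tens_balanced _ _.
by rewrite tlift_tens //; exact: tens_balanced.
Qed.
End Tensor.

Lemma tlift_comp (I I' : Type) (M N M' N' G : zmodType) (r : I -> M -> M)
  (l : I -> N -> N) (r' : I' -> M' -> M') (l' : I' -> N' -> N')
  (f : M -> N -> tensor r' l') (g : M' -> N' -> G) (x : tensor r l) :
  balanced r l f -> balanced r' l' g ->
  tlift g (tlift f x) = tlift (fun m n => tlift g (f m n)) x.
Proof. by move=> fb gb; apply: raddf_tlift fb => // ; apply: tlift_additive. Qed.


Arguments tens {I M N ract lact} m n.
Notation "u \ot v" := (tens u v) (at level 45, no associativity) : ring_scope.

(* Sweedler notation. *)
Notation "\sw_ ( u , v <- x ) E" := (tlift (fun u v => E) x)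
  (at level 46, u name, v name, x at level 50, E at level 46, right associativity,
   format "\sw_ ( u ,  v  <-  x )  E") : ring_scope.

(* M (x) N (x) P / (ract i m (x) n (x) p = m (x) lact i n (x) p,
                    m (x) ract' j n (x) p = m (x) n (x) lact' j p). *)
Section Tensor3.
Variables (I J : Type) (M N P : zmodType).
Variables (ract : I -> M -> M) (lact : I -> N -> N).
Variables (ract' : J -> N -> N) (lact' : J -> P -> P).

Inductive tensor3_rel : {freeg (M * N * P)%type} -> Prop :=
| tensor3_add1 m m' n p : tensor3_rel
    (<< (m + m', n, p) >> - (<< (m, n, p) >> + << (m', n, p) >>))
| tensor3_add2 m n n' p : tensor3_rel
    (<< (m, n + n', p) >> - (<< (m, n, p) >> + << (m, n', p) >>))
| tensor3_add3 m n p p' : tensor3_rel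
    (<< (m, n, p + p') >> - (<< (m, n, p) >> + << (m, n, p') >>))
| tensor3_bal1 i m n p : tensor3_rel
    (<< (ract i m, n, p) >> - << (m, lact i n, p) >>)
| tensor3_bal2 j m n p : tensor3_rel
    (<< (m, ract' j n, p) >> - << (m, n, lact' j p) >>).

Definition tensor3 : Type := presented tensor3_rel.
HB.instance Definition _ := GRing.Zmodule.on tensor3.
Definition tens3 (m : M) (n : N) (p : P) : tensor3 := pgen tensor3_rel (m, n, p).

Definition balanced3 (G : zmodType) (f : M -> N -> P -> G) :=
  [/\ forall m m' n p, f (m + m') n p = f m n p + f m' n p,
      forall m n n' p, f m (n + n') p = f m n p + f m n' p,
      forall m n p p', f m n (p + p') = f m n p + f m n p',
      forall i m n p, f (ract i m) n p = f m (lact i n) p &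
      forall j m n p, f m (ract' j n) p = f m n (lact' j p)].

Lemma tens3_balanced : balanced3 tens3.
Proof.
split=> [m m' n p|m n n' p|m n p p'|i m n p|j m n p].
- exact: pi_genD (tensor3_add1 m m' n p).
- exact: pi_genD (tensor3_add2 m n n' p).
- exact: pi_genD (tensor3_add3 m n p p').
- exact: pi_relB (tensor3_bal1 i m n p).
- exact: pi_relB (tensor3_bal2 j m n p).
Qed.

Definition tlift3 (G : zmodType) (f : M -> N -> P -> G) (x : tensor3) : G :=
  plift (fun p => f p.1.1 p.1.2 p.2) x.

Lemma balanced3_respects (G : zmodType) (f : M -> N -> P -> G) :
  balanced3 f -> respects tensor3_rel (fun p => f p.1.1 p.1.2 p.2).
Proof.
case=> f1 f2 f3 b1 b2 d []; move=> *;
  by rewrite lift_is_additive ?fgliftD !liftU !scale1r /= ?(f1, f2, f3, b1, b2) subrr.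
Qed.

Lemma tlift3_tens (G : zmodType) (f : M -> N -> P -> G) : balanced3 f ->
  forall m n p, tlift3 f (tens3 m n p) = f m n p.
Proof. by move=> /balanced3_respects rf m n p; rewrite /tlift3 plift_gen. Qed.

Lemma tlift3_additive (G : zmodType) (f : M -> N -> P -> G) : balanced3 f ->
  zmod_morphism (tlift3 f).
Proof. by move=> /balanced3_respects /plift_additive. Qed.

Lemma tens3D1 m m' n p : tens3 (m + m') n p = tens3 m n p + tens3 m' n p.
Proof. by have [] := tens3_balanced. Qed.
Lemma tens3D2 m n n' p : tens3 m (n + n') p = tens3 m n p + tens3 m n' p.
Proof. by have [] := tens3_balanced. Qed.
Lemma tens3D3 m n p p' : tens3 m n (p + p') = tens3 m n p + tens3 m n p'.
Proof. by have [] := tens3_balanced. Qed.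
Lemma tens3_bal1 i m n p : tens3 (ract i m) n p = tens3 m (lact i n) p.
Proof. by have [] := tens3_balanced. Qed.
Lemma tens3_bal2 j m n p : tens3 m (ract' j n) p = tens3 m n (lact' j p).
Proof. by have [] := tens3_balanced. Qed.
End Tensor3.

Arguments tens3 {I J M N P ract lact ract' lact'} m n p.


Section LeftBialgebroid.
Variables (k : comPzRingType) (A U : kalgType k).

(* eta : A (x) A^op -> U is given by its two components, the source src and the
   target tgt; the codomain of cop is U_<| (x)_A |>U. *)
Record lbialgebroid_data := LBialgebroidData {
  src : A -> U;
  tgt : A -> U;
  cop : U -> tensor (fun a u => tgt a * u) (fun a v => src a * v);
  cou : U -> A
}.

(* In cop_mul the inner sum is balanced in (u1, u2) for fixed (v1, v2), and the
   outer one is balanced thanks to cop_takeuchi.  That cop is k-linear follows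
   from its A-linearity. *)
Record is_lbialgebroid (D : lbialgebroid_data) : Prop := IsLBialgebroid {
  src_morphism : kalg_morphism (src D);
  tgt_morphism : kalg_morphism (tgt D : A^c -> U);
  src_tgt : forall a b, src D a * tgt D b = tgt D b * src D a;
  cop_additive : zmod_morphism (cop D);
  cop_src : forall a u,
    cop D (src D a * u) = \sw_(u1, u2 <- cop D u) src D a * u1 \ot u2;
  cop_tgt : forall a u,
    cop D (tgt D a * u) = \sw_(u1, u2 <- cop D u) u1 \ot tgt D a * u2;
  cop_coassoc : forall u,
    \sw_(u1, u2 <- cop D u) \sw_(v, w <- cop D u1) tens3 v w u2
    = \sw_(u1, u2 <- cop D u) \sw_(v, w <- cop D u2) tens3 u1 v w
    :> tensor3 (fun a u => tgt D a * u) (fun a v => src D a * v)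
               (fun a v => tgt D a * v) (fun a w => src D a * w);
  cou_additive : zmod_morphism (cou D);
  cou_src : forall a u, cou D (src D a * u) = a * cou D u;
  cou_tgt : forall a u, cou D (tgt D a * u) = cou D u * a;
  cou_copl : forall u, \sw_(u1, u2 <- cop D u) (src D (cou D u1) * u2) = u;
  cou_copr : forall u, \sw_(u1, u2 <- cop D u) (tgt D (cou D u2) * u1) = u;
  cop_takeuchi : forall a u,
    \sw_(u1, u2 <- cop D u) u1 * tgt D a \ot u2
    = \sw_(u1, u2 <- cop D u) u1 \ot u2 * src D a
    :> tensor (fun a u => tgt D a * u) (fun a v => src D a * v);
  cop_one : cop D 1 = 1 \ot 1;
  cop_mul : forall u v,
    cop D (u * v) = \sw_(v1, v2 <- cop D v) \sw_(u1, u2 <- cop D u) u1 * v1 \ot u2 * v2;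
  cou_one : cou D 1 = 1;
  cou_mul_src : forall u v, cou D (u * v) = cou D (u * src D (cou D v));
  cou_mul_tgt : forall u v, cou D (u * v) = cou D (u * tgt D (cou D v))
}.

Record lbialgebroid := LBialgebroid {
  lbialgebroid_of :> lbialgebroid_data;
  lbialgebroidP : is_lbialgebroid lbialgebroid_of
}.

(* alpha_l; in its domain u t(a) (x) v = u (x) t(a) v. *)
Definition galois (D : lbialgebroid_data)
    (x : tensor (fun a u => u * tgt D a) (fun a v => tgt D a * v)) :
  tensor (fun a u => tgt D a * u) (fun a v => src D a * v) :=
  \sw_(u, v <- x) \sw_(u1, u2 <- cop D u) u1 \ot u2 * v.

End LeftBialgebroid.

Section LeftBialgebroidTheory.
Variables (k : comPzRingType) (A U : kalgType k).

Lemma tens_base (D : lbialgebroid_data A U) a u v :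
  tgt D a * u \ot v = u \ot src D a * v
  :> tensor (fun a u => tgt D a * u) (fun a v => src D a * v).
Proof. exact: (@tens_bal _ _ _ (fun a u => tgt D a * u) (fun a v => src D a * v)). Qed.

Lemma balanced_mulr (D : lbialgebroid_data A U) v1 v2 :
  balanced (fun a u => tgt D a * u) (fun a v => src D a * v)
    (fun u1 u2 => u1 * v1 \ot u2 * v2
       : tensor (fun a u => tgt D a * u) (fun a v => src D a * v)).
Proof.
split=> [m m' n|m n n'|b m n]; rewrite ?mulrDl ?tensDl ?tensDr //.
by rewrite -!mulrA tens_base.
Qed.

Variable L : lbialgebroid A U.
Let LP := lbialgebroidP L.

Lemma srcB : zmod_morphism (src L). Proof. by case: (src_morphism LP). Qed.
Lemma srcM a b : src L (a * b) = src L a * src L b.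
Proof. by case: (src_morphism LP) => _ [_ ->]. Qed.
Lemma src1 : src L 1 = 1. Proof. by case: (src_morphism LP) => _ []. Qed.
Lemma srcZ c : src L (scal c) = scal c. Proof. by case: (src_morphism LP). Qed.
Lemma srcD a b : src L (a + b) = src L a + src L b.
Proof. exact: zmod_morphismD srcB _ _. Qed.
Lemma tgtB : zmod_morphism (tgt L). Proof. by case: (tgt_morphism LP). Qed.
Lemma tgtM a b : tgt L (a * b) = tgt L b * tgt L a.
Proof. by case: (tgt_morphism LP) => _ [_ H] _; exact: (H b a). Qed.
Lemma tgt1 : tgt L 1 = 1.
Proof. by case: (tgt_morphism LP) => _ [H _] _; exact: H. Qed.
Lemma tgtZ c : tgt L (scal c) = scal c.
Proof. by case: (tgt_morphism LP) => _ _ H; exact: (H c). Qed.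
Lemma tgtD a b : tgt L (a + b) = tgt L a + tgt L b.
Proof. exact: zmod_morphismD tgtB _ _. Qed.
Lemma copD u v : cop L (u + v) = cop L u + cop L v.
Proof. exact: zmod_morphismD (cop_additive LP) _ _. Qed.
Lemma couD u v : cou L (u + v) = cou L u + cou L v.
Proof. exact: zmod_morphismD (cou_additive LP) _ _. Qed.

Lemma balanced_src a :
  balanced (fun a u => tgt L a * u) (fun a v => src L a * v)
    (fun u1 u2 => src L a * u1 \ot u2
       : tensor (fun a u => tgt L a * u) (fun a v => src L a * v)).
Proof.
split=> [m m' n|m n n'|b m n]; rewrite ?mulrDr ?tensDl ?tensDr //.
by rewrite mulrA (src_tgt LP) -mulrA tens_base.
Qed.

Lemma balanced_tgt a :
  balanced (fun a u => tgt L a * u) (fun a v => src L a * v)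
    (fun u1 u2 => u1 \ot tgt L a * u2
       : tensor (fun a u => tgt L a * u) (fun a v => src L a * v)).
Proof.
split=> [m m' n|m n n'|b m n]; rewrite ?mulrDr ?tensDl ?tensDr //.
by rewrite mulrA -(src_tgt LP) -mulrA tens_base.
Qed.

Lemma takeuchi_mulr a u v1 v2 :
  \sw_(u1, u2 <- cop L u) u1 * (tgt L a * v1) \ot u2 * v2
  = \sw_(u1, u2 <- cop L u) u1 * v1 \ot u2 * (src L a * v2)
  :> tensor (fun a u => tgt L a * u) (fun a v => src L a * v).
Proof.
have b0 := balanced_mulr L v1 v2.
have H1 := congr1 (tlift (fun u1 u2 => u1 * v1 \ot u2 * v2
  : tensor (fun a u => tgt L a * u) (fun a v => src L a * v))) (cop_takeuchi LP a u).
rewrite !tlift_comp // in H1; first last.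
- split=> [m m' n|m n n'|b m n]; rewrite ?mulrDl ?tensDl ?tensDr //.
  by rewrite -!mulrA tens_base.
- split=> [m m' n|m n n'|b m n]; rewrite ?mulrDl ?tensDl ?tensDr //.
  by rewrite -!mulrA tens_base.
rewrite (eq_tlift (g := fun u1 u2 => u1 * (tgt L a * v1) \ot u2 * v2)) in H1; last first.
  by move=> m n; rewrite tlift_tens // mulrA.
rewrite H1; apply: eq_tlift => m n; by rewrite tlift_tens // mulrA.
Qed.

Lemma balanced_cop_mul u :
  balanced (fun a u => tgt L a * u) (fun a v => src L a * v)
    (fun v1 v2 => \sw_(u1, u2 <- cop L u) u1 * v1 \ot u2 * v2
       : tensor (fun a u => tgt L a * u) (fun a v => src L a * v)).
Proof.
split=> [m m' n|m n n'|b m n]; last exact: takeuchi_mulr.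
- rewrite -tliftDf; try exact: balanced_mulr.
  by apply: eq_tlift => p q; rewrite mulrDr tensDl.
- rewrite -tliftDf; try exact: balanced_mulr.
  by apply: eq_tlift => p q; rewrite mulrDr tensDr.
Qed.
Lemma balanced_cop_l (G : zmodType) (g : U -> U -> U -> G) :
  balanced3 (fun a u => tgt L a * u) (fun a v => src L a * v)
            (fun a v => tgt L a * v) (fun a w => src L a * w) g ->
  balanced (fun a u => tgt L a * u) (fun a v => src L a * v)
    (fun u1 u2 => \sw_(v, w <- cop L u1) g v w u2).
Proof.
case=> g1 g2 g3 b1 b2.
have bi z : balanced (fun a u => tgt L a * u) (fun a v => src L a * v)
    (fun v w => g v w z) by split=> *; rewrite ?(g1, g2, b1).
split=> [m m' n|m n n'|b m n]; first by rewrite copD tliftD.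
- by rewrite -tliftDf //; apply: eq_tlift => *; rewrite g3.
- rewrite (cop_tgt LP) tlift_comp //; last exact: balanced_tgt.
  by apply: eq_tlift => p q; rewrite tlift_tens.
Qed.

Lemma balanced_cop_r (G : zmodType) (g : U -> U -> U -> G) :
  balanced3 (fun a u => tgt L a * u) (fun a v => src L a * v)
            (fun a v => tgt L a * v) (fun a w => src L a * w) g ->
  balanced (fun a u => tgt L a * u) (fun a v => src L a * v)
    (fun u1 u2 => \sw_(v, w <- cop L u2) g u1 v w).
Proof.
case=> g1 g2 g3 b1 b2.
have bi z : balanced (fun a u => tgt L a * u) (fun a v => src L a * v)
    (fun v w => g z v w) by split=> *; rewrite ?(g2, g3, b2).
split=> [m m' n|m n n'|b m n]; last 1 first.
- rewrite (cop_src LP) tlift_comp //; last exact: balanced_src.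
  by apply: eq_tlift => p q; rewrite tlift_tens.
- by rewrite -tliftDf //; apply: eq_tlift => *; rewrite g1.
- by rewrite copD tliftD.
Qed.

(* Coassociativity seen through a balanced trilinear map. *)
Lemma cop_coassoc_tlift (G : zmodType) (g : U -> U -> U -> G) u :
  balanced3 (fun a u => tgt L a * u) (fun a v => src L a * v)
            (fun a v => tgt L a * v) (fun a w => src L a * w) g ->
  \sw_(u1, u2 <- cop L u) \sw_(v, w <- cop L u1) g v w u2
  = \sw_(u1, u2 <- cop L u) \sw_(v, w <- cop L u2) g u1 v w.
Proof.
move=> gb; have tb := tens3_balanced (fun a u => tgt L a * u) (fun a v => src L a * v)
            (fun a v => tgt L a * v) (fun a w => src L a * w).
have [t1 t2 t3 b1 b2] := tb.
have gB := tlift3_additive gb.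
have /(congr1 (tlift3 g)) := cop_coassoc LP u.
rewrite (raddf_tlift _ gB (balanced_cop_l tb)) (raddf_tlift _ gB (balanced_cop_r tb)).
under eq_tlift => m n.
  rewrite (raddf_tlift _ gB); last by split=> *; rewrite ?(t1, t2, b1).
  under eq_tlift do rewrite tlift3_tens //.
over.
move=> ->; apply: eq_tlift => m n.
rewrite (raddf_tlift _ gB); last by split=> *; rewrite ?(t2, t3, b2).
by apply: eq_tlift => p q; rewrite tlift3_tens.
Qed.
End LeftBialgebroidTheory.

(* The co-opposite of a left bialgebroid over B, viewed over A by means of an
   isomorphism nu : A -> B^op with inverse nu'. *)
Section Coopposite.
Variables (k : comPzRingType) (A B U : kalgType k).

Definition coop_data (D : lbialgebroid_data B U) (nu : A -> B) (nu' : B -> A) :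
    lbialgebroid_data A U := {|
  src := fun a => tgt D (nu a);
  tgt := fun a => src D (nu a);
  cop := fun u => \sw_(u1, u2 <- cop D u) u2 \ot u1;
  cou := fun u => nu' (cou D u)
|}.

Variables (L : lbialgebroid B U) (nu : A -> B) (nu' : B -> A).
Hypothesis nu_morphism : kalg_morphism (nu : A -> B^c).
Hypotheses (nuK : cancel nu nu') (nuK' : cancel nu' nu).

Local Notation C := (coop_data L nu nu').
Local Notation TL := (tensor (fun b u => tgt L b * u) (fun b v => src L b * v)).
Local Notation TC := (tensor (fun a u => tgt C a * u) (fun a v => src C a * v)).
Local Notation balL := (balanced (fun b u => tgt L b * u) (fun b v => src L b * v)).
Local Notation balC := (balanced (fun a u => tgt C a * u) (fun a v => src C a * v)).

Let LP := lbialgebroidP L.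

Lemma coop_nuM a b : nu (a * b) = nu b * nu a.
Proof. by case: nu_morphism => _ [_ H] _; exact: H. Qed.
Lemma coop_nuB : zmod_morphism nu. Proof. by case: nu_morphism. Qed.
Lemma coop_nu1 : nu 1 = 1.
Proof. by case: nu_morphism => _ [H _] _; exact: H. Qed.
Lemma coop_nuZ c : nu (scal c) = scal c.
Proof. by case: nu_morphism => _ _ H; exact: H. Qed.

Lemma coop_tens b u v : src L b * u \ot v = u \ot tgt L b * v :> TC.
Proof. by rewrite -[b]nuK'; exact: (tens_base C). Qed.

Lemma flip_balanced : balL (fun u v => v \ot u : TC).
Proof. by split=> [m m' n|m n n'|b m n]; rewrite ?tensDl ?tensDr ?coop_tens. Qed.

Definition coop_flip (x : TL) : TC := \sw_(u1, u2 <- x) u2 \ot u1.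
Lemma coop_copE u : cop C u = coop_flip (cop L u). Proof. by []. Qed.
Lemma coop_flipB : zmod_morphism coop_flip.
Proof. exact: tlift_additive flip_balanced. Qed.
Lemma coop_flip_tens u v : coop_flip (u \ot v) = v \ot u.
Proof. by rewrite /coop_flip tlift_tens //; exact: flip_balanced. Qed.

Lemma coop_flip_tlift (f : U -> U -> TL) (x : TL) : balL f ->
  coop_flip (tlift f x) = tlift (fun u v => coop_flip (f u v)) x.
Proof. by move=> fb; apply: raddf_tlift coop_flipB fb. Qed.

Lemma tlift_flip (G : zmodType) (g : U -> U -> G) (x : TL) : balC g ->
  tlift g (coop_flip x) = \sw_(u, v <- x) g v u.
Proof.
move=> gb; rewrite /coop_flip tlift_comp //; last exact: flip_balanced.
by apply: eq_tlift => u v; rewrite tlift_tens.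
Qed.

Lemma coop_is_lbialgebroid : is_lbialgebroid C.
Proof.
have nu'E x y : nu x = nu y -> x = y by exact: (can_inj nuK).
split=> /=.
- split; first by move=> a b; rewrite coop_nuB tgtB.
    split; first by rewrite coop_nu1 tgt1.
    by move=> a b; rewrite coop_nuM tgtM.
  by move=> c; rewrite coop_nuZ tgtZ.
- split; first by move=> a b; rewrite coop_nuB srcB.
    split; first by rewrite coop_nu1; exact: src1.
    by move=> a b; rewrite coop_nuM srcM.
  by move=> c; rewrite coop_nuZ; exact: srcZ.
- by move=> a b; rewrite (src_tgt LP).
- by move=> u v; rewrite (cop_additive LP) -/(coop_flip _) coop_flipB.
- move=> a u; rewrite (cop_tgt LP) -!/(coop_flip _) coop_flip_tlift; last exact: balanced_tgt.
  rewrite tlift_flip; last first.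
    split=> [m m' n|m n n'|b m n]; rewrite ?mulrDr ?tensDl ?tensDr //.
    by rewrite mulrA -(src_tgt LP) -mulrA coop_tens.
  by apply: eq_tlift => m n; rewrite coop_flip_tens.
- move=> a u; rewrite (cop_src LP) -!/(coop_flip _) coop_flip_tlift; last exact: balanced_src.
  rewrite tlift_flip; last first.
    split=> [m m' n|m n n'|b m n]; rewrite ?mulrDr ?tensDl ?tensDr //.
    by rewrite mulrA (src_tgt LP) -mulrA coop_tens.
  by apply: eq_tlift => m n; rewrite coop_flip_tens.
- move=> u; pose T3 := tensor3 (fun a u => src L (nu a) * u) (fun a v => tgt L (nu a) * v)
      (fun a v => src L (nu a) * v) (fun a w => tgt L (nu a) * w).
  have b1 a x y z : tens3 (src L a * x) y z = tens3 x (tgt L a * y) z :> T3.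
    rewrite -[a]nuK'; exact: (tens3_bal1 (fun a u => src L (nu a) * u)).
  have b2 a x y z : tens3 x (src L a * y) z = tens3 x y (tgt L a * z) :> T3.
    rewrite -[a]nuK'; exact: (tens3_bal2 _ _ (fun a u => src L (nu a) * u)).
  pose g x y z : T3 := tens3 z y x.
  have gb : balanced3 (fun a u => tgt L a * u) (fun a v => src L a * v)
                      (fun a v => tgt L a * v) (fun a w => src L a * w) g.
    by rewrite /g; split=> *; rewrite ?tens3D1 ?tens3D2 ?tens3D3 ?b1 ?b2.
  have [bl1 bl2 bl3] := balanced_cop_l gb; have [br1 br2 br3] := balanced_cop_r gb.
  have inl u1 u2 : \sw_(v, w <- coop_flip (cop L u1)) tens3 v w u2
      = \sw_(v, w <- cop L u1) g u2 v w :> T3.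
    rewrite tlift_flip //; split=> [x x' y|x y y'|b x y];
      rewrite ?tens3D1 ?tens3D2 //=; exact: b1.
  have inr u1 u2 : \sw_(v, w <- coop_flip (cop L u2)) tens3 u1 v w
      = \sw_(v, w <- cop L u2) g v w u1 :> T3.
    rewrite tlift_flip //; split=> [x x' y|x y y'|b x y];
      rewrite ?tens3D2 ?tens3D3 //=; exact: b2.
  rewrite -!/(coop_flip _); under eq_tlift do rewrite inl.
  under [RHS]eq_tlift do rewrite inr.
  rewrite !tlift_flip; first by rewrite -cop_coassoc_tlift.
  + by split=> *; rewrite ?bl1 ?bl2 // -bl3.
  + by split=> *; rewrite ?br1 ?br2 // -br3.
- by move=> u v; apply: nu'E; rewrite coop_nuB !nuK' (cou_additive LP).
- by move=> a u; apply: nu'E; rewrite coop_nuM !nuK' (cou_tgt LP).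
- by move=> a u; apply: nu'E; rewrite coop_nuM !nuK' (cou_src LP).
- move=> u; rewrite -!/(coop_flip _) tlift_flip; last first.
    split=> [m m' n|m n n'|b m n]; rewrite nuK' ?(couD, tgtD, mulrDl, mulrDr) ?nuK' //.
    by rewrite (cou_src LP) tgtM mulrA.
  by rewrite -[RHS](cou_copr LP); apply: eq_tlift => m n; rewrite nuK'.
- move=> u; rewrite -!/(coop_flip _) tlift_flip; last first.
    split=> [m m' n|m n n'|b m n]; rewrite !nuK' ?(couD, srcD, mulrDl, mulrDr) ?nuK' //.
    by rewrite (cou_tgt LP) srcM mulrA.
  by rewrite -[RHS](cou_copl LP); apply: eq_tlift => m n; rewrite nuK'.
- move=> a u; rewrite -!/(coop_flip _) !tlift_flip; first last.
  + split=> [m m' n|m n n'|b m n]; rewrite ?mulrDl ?tensDl ?tensDr //.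
    by rewrite -mulrA coop_tens ?mulrA.
  + split=> [m m' n|m n n'|b m n]; rewrite ?mulrDl ?tensDl ?tensDr //.
    by rewrite coop_tens mulrA.
  have /(congr1 coop_flip) := cop_takeuchi LP (nu a) u.
  rewrite !coop_flip_tlift; first last.
  + split=> [m m' n|m n n'|b m n]; rewrite ?mulrDl ?tensDl ?tensDr //.
    by rewrite -!mulrA tens_base.
  + split=> [m m' n|m n n'|b m n]; rewrite ?mulrDl ?tensDl ?tensDr //.
    by rewrite -!mulrA tens_base.
  under eq_tlift do rewrite coop_flip_tens.
  by under [X in _ = X -> _]eq_tlift do rewrite coop_flip_tens.
- by rewrite (cop_one LP) -/(coop_flip _) coop_flip_tens.
- move=> u v; rewrite (cop_mul LP) -!/(coop_flip _) coop_flip_tlift; last exact: balanced_cop_mul.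
  have inner v1 v2 : \sw_(u1, u2 <- coop_flip (cop L u)) u1 * v1 \ot u2 * v2
      = coop_flip (\sw_(u1, u2 <- cop L u) u1 * v2 \ot u2 * v1) :> TC.
    rewrite tlift_flip; last first.
      split=> [m m' n|m n n'|b m n]; rewrite ?mulrDl ?tensDl ?tensDr //.
      by rewrite -!mulrA coop_tens.
    rewrite coop_flip_tlift; last exact: balanced_mulr.
    by apply: eq_tlift => m n; rewrite coop_flip_tens.
  under [RHS]eq_tlift do rewrite inner.
  rewrite tlift_flip //.
  have [b1 b2 b3] := balanced_cop_mul L u.
  split=> [m m' n|m n n'|b m n]; rewrite ?b1 ?b2 ?(zmod_morphismD coop_flipB) //.
  by rewrite -b3.
- by apply: nu'E; rewrite nuK' coop_nu1 (cou_one LP).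
- by move=> u v; apply: nu'E; rewrite !nuK' (cou_mul_tgt LP).
- by move=> u v; apply: nu'E; rewrite !nuK' (cou_mul_src LP).
Qed.

Definition coop : lbialgebroid A U := LBialgebroid coop_is_lbialgebroid.
End Coopposite.

(* A right bialgebroid (V, B) is a left bialgebroid (V^op, B) whose source is the
   target of V and whose target is the source of V. *)
Definition rbialgebroid_data (k : comPzRingType) (B V : kalgType k) :=
  @lbialgebroid_data k B V^c.
Definition rbialgebroid (k : comPzRingType) (B V : kalgType k) :=
  @lbialgebroid k B V^c.
Definition rsrc (k : comPzRingType) (B V : kalgType k)
  (D : rbialgebroid_data B V) : B -> V := tgt D.
Definition rtgt (k : comPzRingType) (B V : kalgType k)
  (D : rbialgebroid_data B V) : B -> V := src D.

Section HopfAlgebroid.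
Variables (k : comPzRingType) (A B H : kalgType k).

(* The summands below are balanced: use antipode_tgt for antipode_l and
   antipode_r, and hopf_src_rtgt to hopf_rtgt_src for the mixed
   coassociativity conditions. *)
Record is_hopf_algebroid (L : lbialgebroid A H) (R : rbialgebroid B H)
    (S : H -> H) : Prop := IsHopfAlgebroid {
  antipode_additive : zmod_morphism S;
  antipode_scal : forall (c : k) h, S (scal c * h) = scal c * S h;
  hopf_src_rtgt : forall b, src L (cou L (rtgt R b)) = rtgt R b;
  hopf_tgt_rsrc : forall b, tgt L (cou L (rsrc R b)) = rsrc R b;
  hopf_rsrc_tgt : forall a, rsrc R (cou R (tgt L a)) = tgt L a;
  hopf_rtgt_src : forall a, rtgt R (cou R (src L a)) = src L a;
  hopf_coassoc_lr : forall h,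
    \sw_(u, v <- cop R h) \sw_(u1, u2 <- cop L u) tens3 u1 u2 v
    = \sw_(u, v <- cop L h) \sw_(v1, v2 <- cop R v) tens3 u v1 v2
    :> tensor3 (fun a (u : H) => tgt L a * u) (fun a (v : H) => src L a * v)
               (fun b (v : H) => v * rsrc R b) (fun b (w : H) => w * rtgt R b);
  hopf_coassoc_rl : forall h,
    \sw_(u, v <- cop L h) \sw_(u1, u2 <- cop R u) tens3 u1 u2 v
    = \sw_(u, v <- cop R h) \sw_(v1, v2 <- cop L v) tens3 u v1 v2
    :> tensor3 (fun b (u : H) => u * rsrc R b) (fun b (v : H) => v * rtgt R b)
               (fun a (v : H) => tgt L a * v) (fun a (w : H) => src L a * w);
  antipode_tgt : forall a (h : H) b,
    S (tgt L a * h * rtgt R b) = rsrc R b * S h * src L a;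
  antipode_l : forall h,
    \sw_(h1, h2 <- cop L h) (S h1 * h2) = rsrc R (cou R h);
  antipode_r : forall h,
    \sw_(h1, h2 <- cop R h) ((h1 : H) * S h2) = src L (cou L h)
}.

Record hopf_algebroid := HopfAlgebroid {
  hopf_l : lbialgebroid A H;
  hopf_r : rbialgebroid B H;
  antipode : H -> H;
  hopf_algebroidP : is_hopf_algebroid hopf_l hopf_r antipode
}.

Variable X : hopf_algebroid.
Local Notation L := (hopf_l X).
Local Notation R := (hopf_r X).
Local Notation S := (antipode X).
Let XP := hopf_algebroidP X.

Definition hopf_nu (a : A) : B := cou R (src L a).
Definition hopf_nu_inv (b : B) : A := cou L (rtgt R b).

Lemma hopf_nuK : cancel hopf_nu hopf_nu_inv.
Proof.
move=> a; rewrite /hopf_nu_inv /hopf_nu (hopf_rtgt_src XP).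
by rewrite -[src L a]mulr1 (cou_src (lbialgebroidP L)) (cou_one (lbialgebroidP L)) mulr1.
Qed.

Lemma hopf_nu_invK : cancel hopf_nu_inv hopf_nu.
Proof.
move=> b; rewrite /hopf_nu_inv /hopf_nu (hopf_src_rtgt XP) /rtgt.
rewrite -[X in cou R X]mulr1 (cou_src (lbialgebroidP R)).
by rewrite (cou_one (lbialgebroidP R)) mulr1.
Qed.

Lemma hopf_nu_morphism : kalg_morphism (hopf_nu : A -> B^c).
Proof.
have RP := lbialgebroidP R; split.
- by move=> a b; rewrite /hopf_nu srcB (cou_additive RP).
- split; first by rewrite /hopf_nu src1; exact: cou_one RP.
  move=> a b; rewrite /hopf_nu srcM -[in LHS](hopf_rtgt_src XP b).
  exact: (cou_src RP).
- move=> c; rewrite /hopf_nu srcZ -(srcZ R) -[src R _]mulr1.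
  by rewrite (cou_src RP) (cou_one RP) mulr1.
Qed.

(* (H^r)^op_coop over A, with source s^r nu, target t^r nu, coproduct
   Delta_r^coop and counit nu^-1 partial. *)
Definition hopf_r_op_coop : @lbialgebroid k A H^c :=
  coop R hopf_nu_morphism hopf_nuK hopf_nu_invK.

End HopfAlgebroid.

#[local] Obligation Tactic := idtac.

(* U^* = Hom_{A^op}(U_<|, A), with the product
   (phi phi')(u) = phi'(s(phi(u_(1))) u_(2)). *)
Section LeftDual.
Variables (k : comPzRingType) (A U : kalgType k) (L : lbialgebroid A U).
Let LP := lbialgebroidP L.

Record ldual : Type := LDual {
  ldual_fun :> U -> A;
  ldual_additive : zmod_morphism ldual_fun;
  ldual_tgt : forall a u, ldual_fun (tgt L a * u) = ldual_fun u * a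
}.
Implicit Types f g h : ldual.

Lemma ldualP f g : (forall u, f u = g u) -> f = g.
Proof.
case: f g => [f f1 f2] [g g1 g2] /= /funext fg; case: g / fg g1 g2 => g1 g2.
by congr LDual; exact: Prop_irrelevance.
Qed.

Lemma ldualD f u v : f (u + v) = f u + f v.
Proof. exact: zmod_morphismD (ldual_additive f) _ _. Qed.

HB.instance Definition _ := gen_eqMixin ldual.
HB.instance Definition _ := gen_choiceMixin ldual.

Program Definition ldual_zero := @LDual (fun=> 0) _ _.
Next Obligation. by move=> u v; rewrite subrr. Qed.
Next Obligation. by move=> a u; rewrite mul0r. Qed.

Program Definition ldual_opp f := @LDual (fun u => - f u) _ _.
Next Obligation. by move=> f u v; rewrite ldual_additive opprD. Qed.
Next Obligation. by move=> f a u /=; rewrite ldual_tgt mulNr. Qed.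

Program Definition ldual_add f g := @LDual (fun u => f u + g u) _ _.
Next Obligation. by move=> f g u v; rewrite !ldual_additive opprD addrACA. Qed.
Next Obligation. by move=> f g a u /=; rewrite !ldual_tgt mulrDl. Qed.

Fact ldual_addA : associative ldual_add.
Proof. by move=> f g h; apply: ldualP => u /=; rewrite addrA. Qed.
Fact ldual_addC : commutative ldual_add.
Proof. by move=> f g; apply: ldualP => u /=; rewrite addrC. Qed.
Fact ldual_add0 : left_id ldual_zero ldual_add.
Proof. by move=> f; apply: ldualP => u /=; rewrite add0r. Qed.
Fact ldual_addN : left_inverse ldual_zero ldual_opp ldual_add.
Proof. by move=> f; apply: ldualP => u /=; rewrite addNr. Qed.
HB.instance Definition _ :=
  GRing.isZmodule.Build ldual ldual_addA ldual_addC ldual_add0 ldual_addN.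

Lemma ldual_balanced f g :
  balanced (fun a u => tgt L a * u) (fun a v => src L a * v)
    (fun u1 u2 => g (src L (f u1) * u2)).
Proof.
split=> [m m' n|m n n'|b m n]; rewrite ?ldualD ?srcD ?mulrDl ?mulrDr ?ldualD //.
by rewrite ldual_tgt srcM mulrA.
Qed.

Program Definition ldual_mul f g :=
  @LDual (fun u => \sw_(u1, u2 <- cop L u) g (src L (f u1) * u2)) _ _.
Next Obligation.
move=> f g u v; rewrite (cop_additive LP) tlift_additive //; exact: ldual_balanced.
Qed.
Next Obligation.
move=> f g a u /=; rewrite (cop_tgt LP) (tlift_comp _ (balanced_tgt L a) (ldual_balanced f g)).
have mulB : zmod_morphism (fun x : A => x * a) by move=> x y; rewrite mulrBl.
rewrite (raddf_tlift _ mulB (ldual_balanced f g)).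
apply: eq_tlift => m n; rewrite tlift_tens; last exact: ldual_balanced.
by rewrite mulrA (src_tgt LP) -mulrA ldual_tgt.
Qed.

Definition ldual_one := LDual (cou_additive LP) (cou_tgt LP).

Fact ldual_mulA : associative ldual_mul.
Proof.
move=> f g h; apply: ldualP => u /=.
pose G x y z := h (src L (g (src L (f x) * y)) * z).
have Gb : balanced3 (fun a u => tgt L a * u) (fun a v => src L a * v)
            (fun a v => tgt L a * v) (fun a w => src L a * w) G.
  rewrite /G; split=> *; rewrite ?(ldualD, srcD, mulrDl, mulrDr) //.
  - by rewrite ldual_tgt srcM mulrA.
  - by rewrite !mulrA (src_tgt LP) -!mulrA ldual_tgt srcM mulrA.
have hB m : zmod_morphism (fun x => h (src L x * m)).
  by move=> x y; rewrite srcB mulrBl ldual_additive.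
transitivity (\sw_(u1, u2 <- cop L u) \sw_(v, w <- cop L u1) G v w u2); last first.
  apply: eq_tlift => m n; rewrite (raddf_tlift _ (hB n)) //; exact: ldual_balanced.
rewrite cop_coassoc_tlift //; apply: eq_tlift => m n.
rewrite (cop_src LP) (tlift_comp _ (balanced_src L _) (ldual_balanced g h)).
by apply: eq_tlift => p q; rewrite tlift_tens //; exact: ldual_balanced.
Qed.
Fact ldual_mul1l : left_id ldual_one ldual_mul.
Proof.
move=> f; apply: ldualP => u /=; rewrite -[in RHS](cou_copl LP u).
rewrite (raddf_tlift _ (ldual_additive f)) //.
by split=> *; rewrite ?couD ?srcD ?mulrDl ?mulrDr // (cou_tgt LP) srcM mulrA.
Qed.
Fact ldual_mul1r : right_id ldual_one ldual_mul.
Proof.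
move=> f; apply: ldualP => u /=; rewrite -[in RHS](cou_copr LP u).
rewrite (raddf_tlift _ (ldual_additive f)).
  by apply: eq_tlift => m n; rewrite (cou_src LP) ldual_tgt.
split=> [m m' n|m n n'|b m n]; rewrite ?couD ?tgtD ?mulrDl ?mulrDr //.
by rewrite (cou_src LP) tgtM mulrA.
Qed.
Fact ldual_mulDl : left_distributive ldual_mul +%R.
Proof.
move=> f g h; apply: ldualP => u /=.
rewrite -(tliftDf _ (ldual_balanced _ _) (ldual_balanced _ _)).
by apply: eq_tlift => m n; rewrite srcD mulrDl ldualD.
Qed.
Fact ldual_mulDr : right_distributive ldual_mul +%R.
Proof.
move=> f g h; apply: ldualP => u /=.
by rewrite -(tliftDf _ (ldual_balanced _ _) (ldual_balanced _ _)).
Qed.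
HB.instance Definition _ := GRing.Zmodule_isPzRing.Build ldual
  ldual_mulA ldual_mul1l ldual_mul1r ldual_mulDl ldual_mulDr.

Program Definition ldual_source a := @LDual (fun u => cou L (u * src L a)) _ _.
Next Obligation. by move=> a u v; rewrite mulrBl (cou_additive LP). Qed.
Next Obligation. by move=> a b u /=; rewrite -mulrA (cou_tgt LP). Qed.

Program Definition ldual_target a := @LDual (fun u => a * cou L u) _ _.
Next Obligation. by move=> a u v; rewrite (cou_additive LP) mulrBr. Qed.
Next Obligation. by move=> a b u /=; rewrite (cou_tgt LP) mulrA. Qed.

Definition ldual_scal (c : k) : ldual := ldual_target (scal c).
Fact ldual_scal_additive : zmod_morphism ldual_scal.
Proof. by move=> c d; apply: ldualP => u /=; rewrite raddfB mulrBl. Qed.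
Fact ldual_scal_l c f u : ldual_mul (ldual_scal c) f u = scal c * f u.
Proof.
rewrite -[in RHS](ldual_mul1l f).
have cB : zmod_morphism (fun x : A => scal c * x) by move=> x y; rewrite mulrBr.
symmetry; apply: etrans (raddf_tlift _ cB (ldual_balanced _ _)) _.
apply: eq_tlift => m n /=.
by rewrite srcM srcZ -(tgtZ L) -mulrA ldual_tgt scalC.
Qed.
Fact ldual_scal_r c f u : ldual_mul f (ldual_scal c) u = scal c * f u.
Proof.
rewrite -[in RHS](ldual_mul1r f).
have cB : zmod_morphism (fun x : A => scal c * x) by move=> x y; rewrite mulrBr.
by symmetry; apply: etrans (raddf_tlift _ cB (ldual_balanced _ _)) _.
Qed.
Fact ldual_scal_monoid : monoid_morphism ldual_scal.
Proof.
split; first by apply: ldualP => u /=; rewrite rmorph1 mul1r.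
by move=> c d; apply: ldualP => u; rewrite [RHS]ldual_scal_l /= rmorphM mulrA.
Qed.
HB.instance Definition _ :=
  GRing.isZmodMorphism.Build k ldual ldual_scal ldual_scal_additive.
HB.instance Definition _ :=
  GRing.isMonoidMorphism.Build k ldual ldual_scal ldual_scal_monoid.
Fact ldual_scalC (c : k) f : ldual_scal c * f = f * ldual_scal c.
Proof. by apply: ldualP => u; rewrite [LHS]ldual_scal_l [RHS]ldual_scal_r. Qed.
HB.instance Definition _ := isKAlgebra.Build k ldual (scal := ldual_scal) ldual_scalC.

(* The coproduct of phi is the z with phi (u u') = z^(1) (u t(z^(2) (u'))); there
   is exactly one when U_<| is finitely generated projective. *)
Definition ldual_cop (f : ldual) :
    tensor (fun a (g : ldual^c) => (ldual_source a : ldual^c) * g)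
           (fun a (g : ldual^c) => (ldual_target a : ldual^c) * g) :=
  xget 0 [set z | forall u u', f (u * u') = \sw_(p, q <- z) (p : ldual) (u * tgt L ((q : ldual) u'))].

(* The source and the target are exchanged, see rbialgebroid_data. *)
Definition ldual_bialgebroid : rbialgebroid_data A ldual :=
  @LBialgebroidData k A ldual^c ldual_target ldual_source ldual_cop (fun f => f 1).

End LeftDual.

(* U_* = Hom_A(|>U, A), with the product
   (psi psi')(u) = psi'(t(psi(u_(2))) u_(1)). *)
Section RightDual.
Variables (k : comPzRingType) (A U : kalgType k) (L : lbialgebroid A U).
Let LP := lbialgebroidP L.

Record rdual : Type := RDual {
  rdual_fun :> U -> A;
  rdual_additive : zmod_morphism rdual_fun;
  rdual_src : forall a u, rdual_fun (src L a * u) = a * rdual_fun u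
}.
Implicit Types f g h : rdual.

Lemma rdualP f g : (forall u, f u = g u) -> f = g.
Proof.
case: f g => [f f1 f2] [g g1 g2] /= /funext fg; case: g / fg g1 g2 => g1 g2.
by congr RDual; exact: Prop_irrelevance.
Qed.

Lemma rdualD f u v : f (u + v) = f u + f v.
Proof. exact: zmod_morphismD (rdual_additive f) _ _. Qed.

HB.instance Definition _ := gen_eqMixin rdual.
HB.instance Definition _ := gen_choiceMixin rdual.

Program Definition rdual_zero := @RDual (fun=> 0) _ _.
Next Obligation. by move=> u v; rewrite subrr. Qed.
Next Obligation. by move=> a u; rewrite mulr0. Qed.

Program Definition rdual_opp f := @RDual (fun u => - f u) _ _.
Next Obligation. by move=> f u v; rewrite rdual_additive opprD. Qed.
Next Obligation. by move=> f a u /=; rewrite rdual_src mulrN. Qed.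

Program Definition rdual_add f g := @RDual (fun u => f u + g u) _ _.
Next Obligation. by move=> f g u v; rewrite !rdual_additive opprD addrACA. Qed.
Next Obligation. by move=> f g a u /=; rewrite !rdual_src mulrDr. Qed.

Fact rdual_addA : associative rdual_add.
Proof. by move=> f g h; apply: rdualP => u /=; rewrite addrA. Qed.
Fact rdual_addC : commutative rdual_add.
Proof. by move=> f g; apply: rdualP => u /=; rewrite addrC. Qed.
Fact rdual_add0 : left_id rdual_zero rdual_add.
Proof. by move=> f; apply: rdualP => u /=; rewrite add0r. Qed.
Fact rdual_addN : left_inverse rdual_zero rdual_opp rdual_add.
Proof. by move=> f; apply: rdualP => u /=; rewrite addNr. Qed.
HB.instance Definition _ :=
  GRing.isZmodule.Build rdual rdual_addA rdual_addC rdual_add0 rdual_addN.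

Lemma rdual_balanced f g :
  balanced (fun a u => tgt L a * u) (fun a v => src L a * v)
    (fun u1 u2 => g (tgt L (f u2) * u1)).
Proof.
split=> [m m' n|m n n'|b m n]; rewrite ?rdualD ?tgtD ?mulrDl ?mulrDr ?rdualD //.
by rewrite rdual_src tgtM mulrA.
Qed.

Program Definition rdual_mul f g :=
  @RDual (fun u => \sw_(u1, u2 <- cop L u) g (tgt L (f u2) * u1)) _ _.
Next Obligation.
move=> f g u v; rewrite (cop_additive LP) tlift_additive //; exact: rdual_balanced.
Qed.
Next Obligation.
move=> f g a u /=; rewrite (cop_src LP) (tlift_comp _ (balanced_src L a) (rdual_balanced f g)).
have mulB : zmod_morphism (fun x : A => a * x) by move=> x y; rewrite mulrBr.
rewrite (raddf_tlift _ mulB (rdual_balanced f g)).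
apply: eq_tlift => m n; rewrite tlift_tens; last exact: rdual_balanced.
by rewrite mulrA -(src_tgt LP) -mulrA rdual_src.
Qed.

Definition rdual_one := RDual (cou_additive LP) (cou_src LP).

Fact rdual_mulA : associative rdual_mul.
Proof.
move=> f g h; apply: rdualP => u /=.
pose G x y z := h (tgt L (g (tgt L (f z) * y)) * x).
have Gb : balanced3 (fun a u => tgt L a * u) (fun a v => src L a * v)
            (fun a v => tgt L a * v) (fun a w => src L a * w) G.
  rewrite /G; split=> *; rewrite ?(rdualD, tgtD, mulrDl, mulrDr) //.
  - by rewrite [in RHS]mulrA -(src_tgt LP) -[in RHS]mulrA rdual_src tgtM mulrA.
  - by rewrite rdual_src tgtM mulrA.
have hB m : zmod_morphism (fun x => h (tgt L x * m)).
  by move=> x y; rewrite tgtB mulrBl rdual_additive.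
transitivity (\sw_(u1, u2 <- cop L u) \sw_(v, w <- cop L u2) G u1 v w); last first.
  apply: eq_tlift => m n; rewrite (raddf_tlift _ (hB m)) //; exact: rdual_balanced.
rewrite -cop_coassoc_tlift //; apply: eq_tlift => m n.
rewrite (cop_tgt LP) (tlift_comp _ (balanced_tgt L _) (rdual_balanced g h)).
by apply: eq_tlift => p q; rewrite tlift_tens //; exact: rdual_balanced.
Qed.
Fact rdual_mul1l : left_id rdual_one rdual_mul.
Proof.
move=> f; apply: rdualP => u /=; rewrite -[in RHS](cou_copr LP u).
rewrite (raddf_tlift _ (rdual_additive f)) //.
by split=> *; rewrite ?couD ?tgtD ?mulrDl ?mulrDr // (cou_src LP) tgtM mulrA.
Qed.
Fact rdual_mul1r : right_id rdual_one rdual_mul.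
Proof.
move=> f; apply: rdualP => u /=; rewrite -[in RHS](cou_copl LP u).
rewrite (raddf_tlift _ (rdual_additive f)).
  by apply: eq_tlift => m n; rewrite (cou_tgt LP) rdual_src.
split=> [m m' n|m n n'|b m n]; rewrite ?couD ?srcD ?mulrDl ?mulrDr //.
by rewrite (cou_tgt LP) srcM mulrA.
Qed.
Fact rdual_mulDl : left_distributive rdual_mul +%R.
Proof.
move=> f g h; apply: rdualP => u /=.
rewrite -(tliftDf _ (rdual_balanced _ _) (rdual_balanced _ _)).
by apply: eq_tlift => m n; rewrite tgtD mulrDl rdualD.
Qed.
Fact rdual_mulDr : right_distributive rdual_mul +%R.
Proof.
move=> f g h; apply: rdualP => u /=.
by rewrite -(tliftDf _ (rdual_balanced _ _) (rdual_balanced _ _)).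
Qed.
HB.instance Definition _ := GRing.Zmodule_isPzRing.Build rdual
  rdual_mulA rdual_mul1l rdual_mul1r rdual_mulDl rdual_mulDr.

Program Definition rdual_source a := @RDual (fun u => cou L u * a) _ _.
Next Obligation. by move=> a u v; rewrite (cou_additive LP) mulrBl. Qed.
Next Obligation. by move=> a b u /=; rewrite (cou_src LP) mulrA. Qed.

Program Definition rdual_target a := @RDual (fun u => cou L (u * tgt L a)) _ _.
Next Obligation. by move=> a u v; rewrite mulrBl (cou_additive LP). Qed.
Next Obligation. by move=> a b u /=; rewrite -mulrA (cou_src LP). Qed.

Definition rdual_scal (c : k) : rdual := rdual_source (scal c).
Fact rdual_scal_additive : zmod_morphism rdual_scal.
Proof. by move=> c d; apply: rdualP => u /=; rewrite raddfB mulrBr. Qed.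
Fact rdual_scal_l c f u : rdual_mul (rdual_scal c) f u = f u * scal c.
Proof.
rewrite -[in RHS](rdual_mul1l f).
have cB : zmod_morphism (fun x : A => x * scal c) by move=> x y; rewrite mulrBl.
symmetry; apply: etrans (raddf_tlift _ cB (rdual_balanced _ _)) _.
apply: eq_tlift => m n /=.
by rewrite tgtM tgtZ -(srcZ L) -mulrA rdual_src scalC.
Qed.
Fact rdual_scal_r c f u : rdual_mul f (rdual_scal c) u = f u * scal c.
Proof.
rewrite -[in RHS](rdual_mul1r f).
have cB : zmod_morphism (fun x : A => x * scal c) by move=> x y; rewrite mulrBl.
by symmetry; apply: etrans (raddf_tlift _ cB (rdual_balanced _ _)) _.
Qed.
Fact rdual_scal_monoid : monoid_morphism rdual_scal.
Proof.
split; first by apply: rdualP => u /=; rewrite rmorph1 mulr1.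
by move=> c d; apply: rdualP => u; rewrite [RHS]rdual_scal_r /= rmorphM mulrA.
Qed.
HB.instance Definition _ :=
  GRing.isZmodMorphism.Build k rdual rdual_scal rdual_scal_additive.
HB.instance Definition _ :=
  GRing.isMonoidMorphism.Build k rdual rdual_scal rdual_scal_monoid.
Fact rdual_scalC (c : k) f : rdual_scal c * f = f * rdual_scal c.
Proof. by apply: rdualP => u; rewrite [LHS]rdual_scal_l [RHS]rdual_scal_r. Qed.
HB.instance Definition _ := isKAlgebra.Build k rdual (scal := rdual_scal) rdual_scalC.

(* The coproduct of psi is the z with psi (u u') = z^(2) (u s(z^(1) (u'))); there
   is exactly one when |>U is finitely generated projective. *)
Definition rdual_cop (f : rdual) :
    tensor (fun a (g : rdual^c) => (rdual_source a : rdual^c) * g)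
           (fun a (g : rdual^c) => (rdual_target a : rdual^c) * g) :=
  xget 0 [set z | forall u u', f (u * u') = \sw_(p, q <- z) (q : rdual) (u * src L ((p : rdual) u'))].

Definition rdual_bialgebroid : rbialgebroid_data A rdual :=
  @LBialgebroidData k A rdual^c rdual_target rdual_source rdual_cop (fun f => f 1).

End RightDual.

Section DualAntipode.
Variables (k : comPzRingType) (A U : kalgType k) (D : lbialgebroid_data A U).

(* u_+ (x) u_- , the preimage of u (x) 1 under the Galois map; meaningful when the
   latter is bijective, that is, for a left Hopf algebroid. *)
Definition translation (u : U) :
    tensor (fun a u => u * tgt D a) (fun a v => tgt D a * v) :=
  xget 0 [set x | galois x = u \ot 1].

Definition dual_antipode (phi : U -> A) (u : U) : A :=
  \sw_(v, w <- translation u) cou D (v * tgt D (phi w)).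
End DualAntipode.

Section Morphism.
Variables (k : comPzRingType) (A U A' U' : kalgType k).

Record is_lbialgebroid_morphism (D : lbialgebroid_data A U)
    (D' : lbialgebroid_data A' U') (F : U -> U') (f : A -> A') : Prop := {
  lmorphism_total : kalg_morphism F;
  lmorphism_base : kalg_morphism f;
  lmorphism_src : forall a, F (src D a) = src D' (f a);
  lmorphism_tgt : forall a, F (tgt D a) = tgt D' (f a);
  lmorphism_cop : forall u, cop D' (F u) = \sw_(u1, u2 <- cop D u) F u1 \ot F u2;
  lmorphism_cou : forall u, cou D' (F u) = f (cou D u)
}.
End Morphism.

(* An algebra map V^op -> V'^op is the same as an algebra map V -> V'. *)
Definition is_rbialgebroid_morphism (k : comPzRingType) (B V B' V' : kalgType k)
    (D : rbialgebroid_data B V) (D' : rbialgebroid_data B' V')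
    (F : V -> V') (f : B -> B') :=
  @is_lbialgebroid_morphism k B V^c B' V'^c D D' F f.

Section FinitelyGeneratedProjective.
Variables (R : pzRingType) (M : lmodType R).

Definition finitely_generated := exists n (e : 'I_n -> M),
  forall m, exists c : 'I_n -> R, m = \sum_i c i *: e i.

Definition projective := forall (X Y : lmodType R)
    (g : {linear X -> Y}) (f : {linear M -> Y}), (forall y, exists x, g x = y) ->
  exists h : {linear M -> X}, forall m, g (h m) = f m.

Definition fg_projective := finitely_generated /\ projective.
End FinitelyGeneratedProjective.

Section BaseModules.
Variables (k : comPzRingType) (A U : kalgType k) (L : lbialgebroid A U).

(* |>U, and U_<| as a left module over A^op. *)
Definition src_module of lbialgebroid_data A U : Type := U.
Definition tgt_module of lbialgebroid_data A U : Type := U.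

HB.instance Definition _ := GRing.Zmodule.copy (src_module L) U.
HB.instance Definition _ := GRing.Zmodule.copy (tgt_module L) U.

Definition src_scale (a : A) (u : src_module L) : src_module L :=
  src L a * (u : U).
Definition tgt_scale (a : A^c) (u : tgt_module L) : tgt_module L :=
  tgt L a * (u : U).

Fact src_scaleA a b u : src_scale a (src_scale b u) = src_scale (a * b) u.
Proof. by rewrite /src_scale srcM mulrA. Qed.
Fact src_scale1 : left_id 1 src_scale.
Proof. by move=> u; rewrite /src_scale src1 mul1r. Qed.
Fact src_scaleDr : right_distributive src_scale +%R.
Proof. by move=> a u v; exact: mulrDr. Qed.
Fact src_scaleDl u : {morph src_scale^~ u : a b / a + b}.
Proof. by move=> a b; rewrite /src_scale srcD; exact: mulrDl. Qed.
HB.instance Definition _ := GRing.Zmodule_isLmodule.Build A (src_module L)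
  src_scaleA src_scale1 src_scaleDr src_scaleDl.

Fact tgt_scaleA a b u : tgt_scale a (tgt_scale b u) = tgt_scale (a * b) u.
Proof. by rewrite /tgt_scale [tgt L (a * b)]tgtM mulrA. Qed.
Fact tgt_scale1 : left_id 1 tgt_scale.
Proof. by move=> u; rewrite /tgt_scale [tgt L 1]tgt1 mul1r. Qed.
Fact tgt_scaleDr : right_distributive tgt_scale +%R.
Proof. by move=> a u v; exact: mulrDr. Qed.
Fact tgt_scaleDl u : {morph tgt_scale^~ u : a b / a + b}.
Proof. by move=> a b; rewrite /tgt_scale [tgt L (a + b)]tgtD; exact: mulrDl. Qed.
HB.instance Definition _ := GRing.Zmodule_isLmodule.Build A^c (tgt_module L)
  tgt_scaleA tgt_scale1 tgt_scaleDr tgt_scaleDl.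
End BaseModules.

(* Main.v *)
(* The antipode S is an isomorphism of left bialgebroids from H^l to
   K = (H^r)^op_coop: it reverses products and coproducts because both members
   of each identity are convolution inverse to the same map.  Hence the
   transposes of S are morphisms of right bialgebroids, and everything attached
   to K is transported from H^l; in particular S^*_r is the conjugate of S^*_l
   by the transposes of S, which is the last identity of the theorem.

   The Galois map of H^l has inverse u (x) v |-> u^(1) (x) S(u^(2)) v, so that
   S^*_l(phi) = eps T_phi with T_phi(u) = u^(1) t(phi(S(u^(2)))).  Moreover
   T_(phi phi') = T_phi' T_phi, and t(S^*_l(phi)(u_(2))) u_(1) = T_phi(u), which
   gives the multiplicativity of S^*_l.  The coproducts of the duals are
   characterised by their defining identities, by means of dual bases. *)

From HB Require Import structures.
Require Import Defs.
From mathcomp Require Import all_boot all_algebra.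
From mathcomp Require classical_sets.
From mathcomp Require Import freeg.

Set Implicit Arguments.
Unset Strict Implicit.
Unset Printing Implicit Defensive.

Import GRing.Theory.
Local Open Scope ring_scope.

#[local] Obligation Tactic := idtac.

(** * Sweedler sums *)

(** The convolution arguments do not take place in one convolution ring. Axiom (4) evaluates
    [S(h_(1)) h_(2)], a sum over [A], as [s^r(partial h)], and [h^(1) S(h^(2))], a sum over [B], as
    [s^l(eps h)]. A left and a right inverse can therefore be compared only through the mixed
    coassociativity of axiom (2): a scalar [s^l(eps h_(2))] is opened as [h_(2)^(1) S(h_(2)^(2))],
    the coproducts are regrouped, and the other half of axiom (4) closes the sum.

    Sums over a coproduct are evaluated on chosen representatives. Additive maps always pass through
    them, but each appeal to coassociativity, to the Takeuchi condition or to linearity of a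
    coproduct requires a balanced summand, whence the many balancedness proofs. *)

Section SweedlerSums.
Variables (I : Type) (M N : zmodType) (ract : I -> M -> M) (lact : I -> N -> N).
Implicit Type x : tensor ract lact.

(* [tlift f x] is a fixed finite integral combination of values of [f], whether
   or not [f] is balanced. *)
Lemma tliftE x : exists (s : seq (M * N)) (c : M * N -> int),
  forall (G : zmodType) (f : M -> N -> G),
  tlift f x = \sum_(p <- s) f p.1 p.2 *~ c p.
Proof.
pose d := repr (x : @Quotient.quot {freeg (M * N)%type}
  (relators (tensor_rel ract lact))).
exists (dom d), (fun p => coeff p d) => G f.
rewrite /tlift /plift -/d; pose f' : M * N -> zmodule G := fun p => f p.1 p.2.
change (fglift f' d = \sum_(p <- dom d) f' p *~ coeff p d).
rewrite -{1}(freeg_sumE d).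
have fB : zmod_morphism (fglift f') by move=> a b; exact: lift_is_additive.
have fD := zmod_morphismD fB; have f0 := zmod_morphism0 fB.
rewrite (big_morph _ fD f0).
by apply: eq_bigr => p _; rewrite liftU /= scalezrE.
Qed.

(** By [tliftE] the sum is a fixed finite integral combination, which every additive map preserves;
    in contrast to [raddf_tlift], the summand may be arbitrary. *)
Lemma raddf_sw (G G' : zmodType) (F : G -> G') (f : M -> N -> G) x :
  zmod_morphism F -> F (tlift f x) = tlift (fun m n => F (f m n)) x.
Proof.
move=> FB; have [s [c E]] := tliftE x; rewrite !E.
have FD := zmod_morphismD FB; have F0 := zmod_morphism0 FB.
have FN := zmod_morphismN FB.
rewrite (big_morph _ FD F0); apply: eq_bigr => p _.
have Fn (g : G) n : F (g *+ n) = F g *+ n.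
  by elim: n => [|n IH]; rewrite ?mulr0n // !mulrS FD IH.
by case: (c p) => n; rewrite ?NegzE ?mulrNz ?FN -!pmulrn Fn.
Qed.

End SweedlerSums.

Lemma sw_exchange (I I' : Type) (M N M' N' G : zmodType)
    (r : I -> M -> M) (l : I -> N -> N) (r' : I' -> M' -> M') (l' : I' -> N' -> N')
    (f : M -> N -> M' -> N' -> G) (x : tensor r l) (y : tensor r' l') :
  \sw_(m, n <- x) \sw_(p, q <- y) f m n p q
  = \sw_(p, q <- y) \sw_(m, n <- x) f m n p q.
Proof.
have [s [c E]] := tliftE x; have [s' [c' E']] := tliftE y.
rewrite E E'; under eq_bigr do rewrite E' mulrz_suml.
under [RHS]eq_bigr do rewrite E mulrz_suml.
rewrite exchange_big; apply: eq_bigr => q _; apply: eq_bigr => p _.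
exact: mulrzAC.
Qed.

(* Unlike in [tlift_comp], only the outer map has to be balanced. *)
Lemma sw_comp (I I' : Type) (M N M' N' G : zmodType)
    (r : I -> M -> M) (l : I -> N -> N) (r' : I' -> M' -> M') (l' : I' -> N' -> N')
    (f : M -> N -> tensor r' l') (g : M' -> N' -> G) (x : tensor r l) :
  balanced r' l' g -> tlift g (tlift f x) = \sw_(m, n <- x) tlift g (f m n).
Proof. by move=> gb; apply: raddf_sw; exact: tlift_additive. Qed.

Lemma sw_add (I : Type) (M N G : zmodType) (r : I -> M -> M) (l : I -> N -> N)
    (f g : M -> N -> G) (x : tensor r l) :
  \sw_(m, n <- x) (f m n + g m n) = tlift f x + tlift g x.
Proof.
have [s [c E]] := tliftE x; rewrite !E -big_split.
by apply: eq_bigr => p _; rewrite mulrzDl.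
Qed.

Lemma sw_sum (I J : Type) (M N G : zmodType) (r : I -> M -> M) (l : I -> N -> N)
    (s : seq J) (f : J -> M -> N -> G) (x : tensor r l) :
  \sw_(m, n <- x) \sum_(j <- s) f j m n = \sum_(j <- s) tlift (f j) x.
Proof.
have [t [c E]] := tliftE x; rewrite E.
under eq_bigr do rewrite mulrz_suml.
by rewrite exchange_big; apply: eq_bigr => j _; rewrite E.
Qed.

Lemma sw_comp3 (I I' J J' : Type) (M N P M1 N1 M2 N2 G : zmodType)
    (r : I -> M -> M) (l : I -> N -> N) (r' : J -> N -> N) (l' : J -> P -> P)
    (r1 : I' -> M1 -> M1) (l1 : I' -> N1 -> N1)
    (r2 : J' -> M2 -> M2) (l2 : J' -> N2 -> N2)
    (f : M1 -> N1 -> tensor r2 l2) (h : M1 -> N1 -> M2 -> N2 -> tensor3 r l r' l')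
    (g : M -> N -> P -> G) (x : tensor r1 l1) :
  balanced3 r l r' l' g ->
  tlift3 g (\sw_(m, n <- x) \sw_(p, q <- f m n) h m n p q)
  = \sw_(m, n <- x) \sw_(p, q <- f m n) tlift3 g (h m n p q).
Proof.
move=> gb; have gB := tlift3_additive gb; rewrite (raddf_sw _ _ gB).
by apply: eq_tlift => m n; exact: raddf_sw.
Qed.

(** * Coproducts of the duals *)

(** Projectivity splits the surjection onto [M] from the free module of rows given by the
    generators; the coordinates of the splitting are the dual forms. *)
Lemma fg_projective_dual_basis (R : pzRingType) (M : lmodType R) :
  fg_projective M ->
  exists n (e : 'I_n -> M) (h : {linear M -> 'rV[R]_n}),
    forall m, m = \sum_i h m 0 i *: e i.
Proof.
case=> -[n [e eP]] prj.
pose g (c : 'rV[R]_n) : M := \sum_i c 0 i *: e i.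
have gL : linear g.
  move=> a c d; rewrite /g scaler_sumr -big_split; apply: eq_bigr => i _.
  by rewrite !mxE scalerDl scalerA.
pose gM := GRing.isLinear.Build R _ _ _ g gL.
pose G : {linear 'rV[R]_n -> M} := HB.pack g gM.
have Gsurj (m : M) : exists x, G x = m.
  have [c ->] := eP m; exists (\row_i c i).
  by apply: eq_bigr => i _; rewrite mxE.
have [h hP] := prj _ _ G (idfun : {linear M -> M}) Gsurj.
by exists n, e, h => m; rewrite -{1}[m]/(idfun m) -hP.
Qed.

(** * Sums over the coproduct of a left bialgebroid *)

Section BialgebroidTheory.
Variables (k : comPzRingType) (A U : kalgType k) (L : lbialgebroid A U).
Let LP := lbialgebroidP L.

Local Notation bal := (balanced (fun a u => tgt L a * u) (fun a v => src L a * v)).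

Lemma cop_srcE a : cop L (src L a) = src L a \ot 1.
Proof.
rewrite -[src L a]mulr1 (cop_src LP) (cop_one LP) tlift_tens //.
exact: balanced_src.
Qed.

Lemma cop_tgtE a : cop L (tgt L a) = 1 \ot tgt L a.
Proof.
rewrite -[tgt L a]mulr1 (cop_tgt LP) (cop_one LP) tlift_tens //.
exact: balanced_tgt.
Qed.

Lemma cou_srcE a : cou L (src L a) = a.
Proof. by rewrite -[src L a]mulr1 (cou_src LP) (cou_one LP) mulr1. Qed.

Lemma cou_tgtE a : cou L (tgt L a) = a.
Proof. by rewrite -[tgt L a]mulr1 (cou_tgt LP) (cou_one LP) mul1r. Qed.

Lemma sw_cop_mul_src (G : zmodType) (g : U -> U -> G) a u : bal g ->
  tlift g (cop L (u * src L a)) = \sw_(u1, u2 <- cop L u) g (u1 * src L a) u2.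
Proof.
move=> gb; rewrite (cop_mul LP) cop_srcE (sw_comp _ _ gb) tlift_tens.
  rewrite (sw_comp _ _ gb); apply: eq_tlift => m n.
  by rewrite tlift_tens // mulr1.
have [b1 b2 b3] := balanced_cop_mul L u.
by split=> *; rewrite ?(b1, b2, b3) // (zmod_morphismD (tlift_additive gb)).
Qed.

Lemma sw_cop_mul_tgt (G : zmodType) (g : U -> U -> G) a u : bal g ->
  tlift g (cop L (u * tgt L a)) = \sw_(u1, u2 <- cop L u) g u1 (u2 * tgt L a).
Proof.
move=> gb; rewrite (cop_mul LP) cop_tgtE (sw_comp _ _ gb) tlift_tens.
  rewrite (sw_comp _ _ gb); apply: eq_tlift => m n.
  by rewrite tlift_tens // mulr1.
have [b1 b2 b3] := balanced_cop_mul L u.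
by split=> *; rewrite ?(b1, b2, b3) // (zmod_morphismD (tlift_additive gb)).
Qed.

Lemma sw_cop_takeuchi (G : zmodType) (g : U -> U -> G) a u : bal g ->
  \sw_(u1, u2 <- cop L u) g (u1 * tgt L a) u2
  = \sw_(u1, u2 <- cop L u) g u1 (u2 * src L a).
Proof.
move=> gb; have := congr1 (tlift g) (cop_takeuchi LP a u).
rewrite !(sw_comp _ _ gb); under eq_tlift do rewrite tlift_tens //.
by under [X in _ = X -> _]eq_tlift do rewrite tlift_tens //.
Qed.

Lemma sw_cop_src (G : zmodType) (g : U -> U -> G) a u : bal g ->
  tlift g (cop L (src L a * u)) = \sw_(u1, u2 <- cop L u) g (src L a * u1) u2.
Proof.
move=> gb; rewrite (cop_src LP) (sw_comp _ _ gb).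
by apply: eq_tlift => m n; rewrite tlift_tens.
Qed.

Lemma sw_cop_tgt (G : zmodType) (g : U -> U -> G) a u : bal g ->
  tlift g (cop L (tgt L a * u)) = \sw_(u1, u2 <- cop L u) g u1 (tgt L a * u2).
Proof.
move=> gb; rewrite (cop_tgt LP) (sw_comp _ _ gb).
by apply: eq_tlift => m n; rewrite tlift_tens.
Qed.

Lemma sw_cop_mul (G : zmodType) (g : U -> U -> G) u v : bal g ->
  tlift g (cop L (u * v))
  = \sw_(v1, v2 <- cop L v) \sw_(u1, u2 <- cop L u) g (u1 * v1) (u2 * v2).
Proof.
move=> gb; rewrite (cop_mul LP) (sw_comp _ _ gb); apply: eq_tlift => m n.
by rewrite (sw_comp _ _ gb); apply: eq_tlift => p q; rewrite tlift_tens.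
Qed.

End BialgebroidTheory.

(** * Coproduct of the left dual *)

Section LeftDualCoproduct.
Variables (k : comPzRingType) (A U : kalgType k) (L : lbialgebroid A U).
Let LP := lbialgebroidP L.

(** Finite projectivity of [U_<|], with the coordinate forms taken in [ldual L]: in this form it
    passes along isomorphisms of bialgebroids by transposing the forms. *)
Definition has_ldual_basis := exists n (e : 'I_n -> U) (f : 'I_n -> ldual L),
  forall u, u = \sum_i tgt L (f i u) * e i.

Lemma fgp_ldual_basis : fg_projective (tgt_module L) -> has_ldual_basis.
Proof.
case/fg_projective_dual_basis=> n [e [h hP]].
have fB i : zmod_morphism (fun u : U => h u 0 i : A).
  by move=> u v; rewrite [h _]raddfB !mxE.
have ft i a (u : U) : (h (tgt L a * u) 0 i : A) = (h u 0 i : A) * a.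
  apply: etrans (congr1 (fun v : 'rV_n => v 0 i) (linearZZ h (a : A^c) (u : tgt_module L))) _.
  by rewrite mxE.
by exists n, e, (fun i => LDual (fB i) (ft i)).
Qed.

Lemma ldual_sumE (J : Type) (s : seq J) (f : J -> ldual L) u :
  (\sum_(j <- s) f j) u = \sum_(j <- s) f j u.
Proof. exact: (big_morph (fun g : ldual L => g u)). Qed.

(** The Takeuchi condition turns [u_(2) s(a)] inside the counit into [u_(1) t(a)], and the counit
    then reassembles [u t(a)]. This is what makes the pairing [ldual_eval] balanced. *)
Lemma ldual_mul_source (g : ldual L) a u : (g * ldual_source L a) u = g (u * tgt L a).
Proof.
have gb : balanced (fun a u => tgt L a * u) (fun a v => src L a * v)
    (fun u1 u2 => g (tgt L (cou L u2) * u1)).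
  split=> *; rewrite ?(couD, tgtD, mulrDl, mulrDr, ldualD) //.
  by rewrite (cou_src LP) tgtM mulrA.
transitivity (\sw_(u1, u2 <- cop L u) g (tgt L (cou L (u2 * src L a)) * u1)).
  by apply: eq_tlift => m n /=; rewrite ldual_tgt -mulrA (cou_src LP).
have gB : zmod_morphism (fun x => g (x * tgt L a)).
  by move=> x y; rewrite mulrBl ldual_additive.
rewrite -(sw_cop_takeuchi _ _ gb) -[in RHS](cou_copr LP u) (raddf_sw _ _ gB).
by apply: eq_tlift => m n; rewrite mulrA.
Qed.

Lemma ldual_mul_target (g : ldual L) a u : (g * ldual_target L a) u = a * g u.
Proof.
have aB : zmod_morphism (fun x : A => a * x) by move=> x y; rewrite mulrBr.
by rewrite -[in RHS](mulr1 g) [in RHS](raddf_sw _ _ aB).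
Qed.

Definition ldual_eval (u u' : U) (p q : ldual L) : A := p (u * tgt L (q u')).

Local Notation ract := (fun a (g : (ldual L)^c) => (ldual_source L a : (ldual L)^c) * g).
Local Notation lact := (fun a (g : (ldual L)^c) => (ldual_target L a : (ldual L)^c) * g).

Lemma ldual_eval_balanced u u' : balanced ract lact (ldual_eval u u').
Proof.
rewrite /ldual_eval; split=> [//|m n n'|a m n]; first by rewrite tgtD mulrDr ldualD.
rewrite [LHS]ldual_mul_source.
by rewrite -mulrA -tgtM -(ldual_mul_target n a u').
Qed.

Hypothesis basis : has_ldual_basis.

Lemma ldual_copP (f : ldual L) u u' :
  f (u * u') = tlift (ldual_eval u u') (ldual_cop f).
Proof.
have [n [e [d dE]]] := basis.
have fB i : zmod_morphism (fun u => f (u * e i)).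
  by move=> x y; rewrite mulrBl ldual_additive.
have ft i a x : f (tgt L a * x * e i) = f (x * e i) * a by rewrite -mulrA ldual_tgt.
suff ex : exists z : tensor ract lact, forall u u', f (u * u') = tlift (ldual_eval u u') z.
  exact: (classical_sets.xgetPex 0 ex).
(* Forced by expanding the second factor: [f(u u')] is the sum of the [f(u t(d_i(u')) e_i)], which
   pairs [f(- e_i)] with [d_i]. *)
exists (\sum_i (LDual (fB i) (ft i) \ot d i)) => v v'.
have eB := tlift_additive (ldual_eval_balanced v v').
rewrite (big_morph _ (zmod_morphismD eB) (zmod_morphism0 eB)).
rewrite {1}(dE v') mulr_sumr.
rewrite (big_morph f (@ldualD _ _ _ _ f) (zmod_morphism0 (ldual_additive f))).
apply: eq_bigr => i _; rewrite tlift_tens; last exact: ldual_eval_balanced.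
by rewrite /ldual_eval /= mulrA.
Qed.

(** The evaluations separate tensors: the dual basis writes any [w] as a sum of terms [x_i \ot d_i],
    where [x_i] at [u] is the value of [ldual_eval u (e i)] on [w]. *)
Lemma ldual_cop_uniq (f : ldual L) (z : tensor ract lact) :
  (forall u u', f (u * u') = tlift (ldual_eval u u') z) -> ldual_cop f = z.
Proof.
have [n [e [d dE]]] := basis.
suff inj (x y : tensor ract lact) :
    (forall u u', tlift (ldual_eval u u') x = tlift (ldual_eval u u') y) -> x = y.
  by move=> fz; apply: inj => u u'; rewrite -ldual_copP.
have expand (w : tensor ract lact) :
    w = \sum_i (tlift (fun p q : ldual L => p * ldual_source L (q (e i))) w \ot d i).
  rewrite -[LHS]tlift_id.
  have tB i : zmod_morphism (fun p => p \ot d i : tensor ract lact).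
    by move=> p q; apply: (canRL (addrK _)); rewrite -tensDl subrK.
  under eq_bigr => i _ do rewrite (raddf_sw _ _ (tB i)).
  rewrite -sw_sum; apply: eq_tlift => p q.
  have qE : q = \sum_i d i * ldual_target L ((q : ldual L) (e i)).
    apply: ldualP => u; rewrite ldual_sumE {1}(dE u).
    rewrite (big_morph q (@ldualD _ _ _ _ q) (zmod_morphism0 (ldual_additive q))).
    by apply: eq_bigr => i _; rewrite ldual_tgt ldual_mul_target.
  have t0 (p' : ldual L) : p' \ot (0 : ldual L) = 0 :> tensor ract lact.
    by apply: (addrI (p' \ot 0)); rewrite -tensDr !addr0.
  rewrite {1}qE (big_morph (tens (p : ldual L)) (tensDr ract lact p) (t0 p)).
  by apply: eq_bigr => i _; rewrite -tens_bal.
move=> xy; rewrite (expand x) (expand y); apply: eq_bigr => i _; congr (_ \ot _).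
apply: ldualP => u.
have evB : zmod_morphism (fun g : ldual L => g u) by [].
rewrite !(raddf_sw _ _ evB).
have ev (w : tensor ract lact) : tlift (fun p q : ldual L => (p * ldual_source L (q (e i))) u) w
    = tlift (ldual_eval u (e i)) w.
  by apply: eq_tlift => p q; rewrite ldual_mul_source.
by rewrite !ev.
Qed.

End LeftDualCoproduct.

(** * Coproduct of the right dual *)

Section RightDualCoproduct.
Variables (k : comPzRingType) (A U : kalgType k) (L : lbialgebroid A U).
Let LP := lbialgebroidP L.

Definition has_rdual_basis := exists n (e : 'I_n -> U) (f : 'I_n -> rdual L),
  forall u, u = \sum_i src L (f i u) * e i.

Lemma fgp_rdual_basis : fg_projective (src_module L) -> has_rdual_basis.
Proof.
case/fg_projective_dual_basis=> n [e [h hP]].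
have fB i : zmod_morphism (fun u : U => h u 0 i : A).
  by move=> u v; rewrite [h _]raddfB !mxE.
have fs i a (u : U) : (h (src L a * u) 0 i : A) = a * (h u 0 i : A).
  apply: etrans (congr1 (fun v : 'rV_n => v 0 i) (linearZZ h a (u : src_module L))) _.
  by rewrite mxE.
by exists n, e, (fun i => RDual (fB i) (fs i)).
Qed.

Lemma rdual_sumE (J : Type) (s : seq J) (f : J -> rdual L) u :
  (\sum_(j <- s) f j) u = \sum_(j <- s) f j u.
Proof. exact: (big_morph (fun g : rdual L => g u)). Qed.

Lemma rdual_mul_source (g : rdual L) a u : (g * rdual_source L a) u = g u * a.
Proof.
have aB : zmod_morphism (fun x : A => x * a) by move=> x y; rewrite mulrBl.
by rewrite -[in RHS](mulr1 g) [in RHS](raddf_sw _ _ aB).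
Qed.

Lemma rdual_mul_target (g : rdual L) a u : (g * rdual_target L a) u = g (u * src L a).
Proof.
have gb : balanced (fun a u => tgt L a * u) (fun a v => src L a * v)
    (fun u1 u2 => g (src L (cou L u1) * u2)).
  split=> *; rewrite ?(couD, srcD, mulrDl, mulrDr, rdualD) //.
  by rewrite (cou_tgt LP) srcM mulrA.
transitivity (\sw_(u1, u2 <- cop L u) g (src L (cou L (u1 * tgt L a)) * u2)).
  by apply: eq_tlift => m n /=; rewrite rdual_src -mulrA (cou_tgt LP).
have gB : zmod_morphism (fun x => g (x * src L a)).
  by move=> x y; rewrite mulrBl rdual_additive.
rewrite (sw_cop_takeuchi _ _ gb) -[in RHS](cou_copl LP u) (raddf_sw _ _ gB).
by apply: eq_tlift => m n; rewrite mulrA.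
Qed.

Definition rdual_eval (u u' : U) (p q : rdual L) : A := q (u * src L (p u')).

Local Notation ract := (fun a (g : (rdual L)^c) => (rdual_source L a : (rdual L)^c) * g).
Local Notation lact := (fun a (g : (rdual L)^c) => (rdual_target L a : (rdual L)^c) * g).

Lemma rdual_eval_balanced u u' : balanced ract lact (rdual_eval u u').
Proof.
rewrite /rdual_eval; split=> [m m' n|//|a m n]; first by rewrite srcD mulrDr rdualD.
rewrite [RHS]rdual_mul_target.
by rewrite -mulrA -srcM -(rdual_mul_source m a u').
Qed.

Hypothesis basis : has_rdual_basis.

Lemma rdual_copP (f : rdual L) u u' :
  f (u * u') = tlift (rdual_eval u u') (rdual_cop f).
Proof.
have [n [e [d dE]]] := basis.
have fB i : zmod_morphism (fun u => f (u * e i)).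
  by move=> x y; rewrite mulrBl rdual_additive.
have fs i a x : f (src L a * x * e i) = a * f (x * e i) by rewrite -mulrA rdual_src.
suff ex : exists z : tensor ract lact, forall u u', f (u * u') = tlift (rdual_eval u u') z.
  exact: (classical_sets.xgetPex 0 ex).
(* Again [u'] is expanded, but its forms [d i] now occupy the first leg, in accordance with the
   crossed pairing [rdual_eval]. *)
exists (\sum_i (d i \ot RDual (fB i) (fs i))) => v v'.
have eB := tlift_additive (rdual_eval_balanced v v').
rewrite (big_morph _ (zmod_morphismD eB) (zmod_morphism0 eB)).
rewrite {1}(dE v') mulr_sumr.
rewrite (big_morph f (@rdualD _ _ _ _ f) (zmod_morphism0 (rdual_additive f))).
apply: eq_bigr => i _; rewrite tlift_tens; last exact: rdual_eval_balanced.
by rewrite /rdual_eval /= mulrA.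
Qed.

Lemma rdual_cop_uniq (f : rdual L) (z : tensor ract lact) :
  (forall u u', f (u * u') = tlift (rdual_eval u u') z) -> rdual_cop f = z.
Proof.
have [n [e [d dE]]] := basis.
suff inj (x y : tensor ract lact) :
    (forall u u', tlift (rdual_eval u u') x = tlift (rdual_eval u u') y) -> x = y.
  by move=> fz; apply: inj => u u'; rewrite -rdual_copP.
have expand (w : tensor ract lact) :
    w = \sum_i (d i \ot tlift (fun p q : rdual L => q * rdual_target L (p (e i))) w).
  rewrite -[LHS]tlift_id.
  have tB i : zmod_morphism (fun q => d i \ot q : tensor ract lact).
    by move=> p q; apply: (canRL (addrK _)); rewrite -tensDr subrK.
  under eq_bigr => i _ do rewrite (raddf_sw _ _ (tB i)).
  rewrite -sw_sum; apply: eq_tlift => p q.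
  have pE : p = \sum_i d i * rdual_source L ((p : rdual L) (e i)).
    apply: rdualP => u; rewrite rdual_sumE {1}(dE u).
    rewrite (big_morph p (@rdualD _ _ _ _ p) (zmod_morphism0 (rdual_additive p))).
    by apply: eq_bigr => i _; rewrite rdual_src rdual_mul_source.
  have t0 (q' : rdual L) : (0 : rdual L) \ot q' = 0 :> tensor ract lact.
    by apply: (addrI (0 \ot q')); rewrite -tensDl !addr0.
  have tD p1 p2 : (p1 + p2) \ot q = p1 \ot q + p2 \ot q :> tensor ract lact.
    exact: tensDl.
  rewrite {1}pE (big_morph (fun p' : rdual L => p' \ot (q : rdual L)) tD (t0 q)).
  by apply: eq_bigr => i _; rewrite -tens_bal.
move=> xy; rewrite (expand x) (expand y); apply: eq_bigr => i _; congr (_ \ot _).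
apply: rdualP => u.
have evB : zmod_morphism (fun g : rdual L => g u) by [].
rewrite !(raddf_sw _ _ evB).
have ev (w : tensor ract lact) : tlift (fun p q : rdual L => (q * rdual_target L (p (e i))) u) w
    = tlift (rdual_eval u (e i)) w.
  by apply: eq_tlift => p q; rewrite rdual_mul_target.
by rewrite !ev.
Qed.

End RightDualCoproduct.

(** * Morphisms of bialgebroids *)

Section Morphisms.
Variables (k : comPzRingType) (A U V : kalgType k).
Variables (D : lbialgebroid_data A U) (D' : lbialgebroid_data A V).

Definition bmap (F : U -> V)
    (x : tensor (fun a u => tgt D a * u) (fun a v => src D a * v)) :
    tensor (fun a u => tgt D' a * u) (fun a v => src D' a * v) :=
  \sw_(u, v <- x) F u \ot F v.

Definition base_algebra_morphism (F : U -> V) :=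
  [/\ kalg_morphism F, forall a, F (src D a) = src D' a
    & forall a, F (tgt D a) = tgt D' a].

Lemma bmap_balanced (F : U -> V) : base_algebra_morphism F ->
  balanced (fun a u => tgt D a * u) (fun a v => src D a * v)
    (fun u v => F u \ot F v : tensor (fun a u => tgt D' a * u) (fun a v => src D' a * v)).
Proof.
case=> -[FB [F1 FM] _] Fs Ft; have FD := zmod_morphismD FB.
by split=> *; rewrite ?FD ?tensDl ?tensDr // !FM Fs Ft tens_base.
Qed.

Lemma lmorphism_algebra (F : U -> V) :
  is_lbialgebroid_morphism D D' F id -> base_algebra_morphism F.
Proof. by case. Qed.
End Morphisms.

Arguments bmap {k A U V} D D' F x.

Section MorphismOperations.
Variables (k : comPzRingType) (A U V W : kalgType k).
Variables (D : lbialgebroid_data A U) (D' : lbialgebroid_data A V).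
Variables (D'' : lbialgebroid_data A W).

Lemma lmorphism_comp (F : U -> V) (G : V -> W) :
  is_lbialgebroid_morphism D D' F id -> is_lbialgebroid_morphism D' D'' G id ->
  is_lbialgebroid_morphism D D'' (G \o F) id.
Proof.
move=> FP GP; have Gb := bmap_balanced (lmorphism_algebra GP).
case: FP => -[FB [F1 FM] FZ] idP Fs Ft Fcop Fcou.
case: GP Gb => -[GB [G1 GM] GZ] _ Gs Gt Gcop Gcou Gb.
split=> //= [|a|a|u|u]; rewrite ?Fs ?Ft ?Gs ?Gt //; last by rewrite Gcou Fcou.
  split=> [u v|| c] /=; first by rewrite FB GB.
    by split=> [|u v] /=; rewrite ?F1 // FM GM.
  by rewrite FZ GZ.
rewrite Gcop Fcop (sw_comp _ _ Gb); apply: eq_tlift => m n.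
exact: tlift_tens Gb _ _.
Qed.

Lemma lmorphism_inv (F : U -> V) (G : V -> U) :
  cancel F G -> cancel G F ->
  is_lbialgebroid_morphism D D' F id -> is_lbialgebroid_morphism D' D G id.
Proof.
move=> FK GK [[FB [F1 FM] FZ] idP Fs Ft Fcop Fcou].
have Galg : base_algebra_morphism D' D G.
  split=> [|a|a]; [|by rewrite -[src D' a]Fs FK|by rewrite -[tgt D' a]Ft FK].
  split=> [u v||c]; last by rewrite -FZ FK.
    by apply: (can_inj FK); rewrite FB !GK.
  by split=> [|u v]; apply: (can_inj FK); rewrite ?F1 ?FM !GK.
have Gb := bmap_balanced Galg.
case: Galg => Gk Gs Gt; split=> // v; last by rewrite -[in RHS](GK v) Fcou.
rewrite -[in RHS](GK v) Fcop (sw_comp _ _ Gb) -[LHS]tlift_id.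
by apply: eq_tlift => m n; rewrite tlift_tens // !FK.
Qed.
End MorphismOperations.

(** * Transposes and transported dual bases *)

Section Transposes.
Variables (k : comPzRingType) (A U V : kalgType k).
Variables (L : lbialgebroid A U) (L' : lbialgebroid A V) (F : U -> V).
Hypothesis FP : is_lbialgebroid_morphism L L' F id.

Let FB : zmod_morphism F. Proof. by case: FP => -[]. Qed.
Let FM u v : F (u * v) = F u * F v. Proof. by case: FP => -[_ [_ ->]]. Qed.
Let F1 : F 1 = 1. Proof. by case: FP => -[_ []]. Qed.
Let Fs := lmorphism_src FP.
Let Ft := lmorphism_tgt FP.

Program Definition ltranspose (f : ldual L') : ldual L := @LDual _ _ _ _ (f \o F) _ _.
Next Obligation. by move=> f u v /=; rewrite FB ldual_additive. Qed.
Next Obligation. by move=> f a u /=; rewrite FM Ft ldual_tgt. Qed.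

Program Definition rtranspose (f : rdual L') : rdual L := @RDual _ _ _ _ (f \o F) _ _.
Next Obligation. by move=> f u v /=; rewrite FB rdual_additive. Qed.
Next Obligation. by move=> f a u /=; rewrite FM Fs rdual_src. Qed.

(** For coproducts, uniqueness over [L] reduces the claim to the defining identity over [L'],
    applied to [F(u u') = F(u) F(u')]; hence a dual basis on each side. *)
Lemma ltranspose_morphism :
  has_ldual_basis L -> has_ldual_basis L' ->
  is_rbialgebroid_morphism (ldual_bialgebroid L') (ldual_bialgebroid L) ltranspose id.
Proof.
move=> basisL basisL'.
have Fcou := lmorphism_cou FP.
have tM (f g : ldual L') : ltranspose (f * g) = ltranspose f * ltranspose g.
  apply: ldualP => u /=.
  rewrite (lmorphism_cop FP) (sw_comp _ _ (ldual_balanced f g)).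
  apply: eq_tlift => m n; rewrite tlift_tens; last exact: ldual_balanced.
  by rewrite FM Fs.
split=> //=.
- split=> [f g||c]; [exact: ldualP| |].
    by split=> [|f g]; [apply: ldualP => u /=; rewrite Fcou | exact: tM].
  by apply: ldualP => u /=; rewrite Fcou.
- by move=> a; apply: ldualP => u /=; rewrite Fcou.
- by move=> a; apply: ldualP => u /=; rewrite -Fs -FM Fcou.
- move=> f; apply: ldual_cop_uniq => // u u'.
  rewrite (sw_comp _ _ (ldual_eval_balanced L u u')) /= FM (ldual_copP basisL').
  apply: eq_tlift => p q; rewrite tlift_tens; last exact: ldual_eval_balanced.
  by rewrite /ldual_eval /= FM Ft.
- by move=> f; rewrite F1.
Qed.

Lemma rtranspose_morphism :
  has_rdual_basis L -> has_rdual_basis L' ->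
  is_rbialgebroid_morphism (rdual_bialgebroid L') (rdual_bialgebroid L) rtranspose id.
Proof.
move=> basisL basisL'.
have Fcou := lmorphism_cou FP.
have tM (f g : rdual L') : rtranspose (f * g) = rtranspose f * rtranspose g.
  apply: rdualP => u /=.
  rewrite (lmorphism_cop FP) (sw_comp _ _ (rdual_balanced f g)).
  apply: eq_tlift => m n; rewrite tlift_tens; last exact: rdual_balanced.
  by rewrite FM Ft.
split=> //=.
- split=> [f g||c]; [exact: rdualP| |].
    by split=> [|f g]; [apply: rdualP => u /=; rewrite Fcou | exact: tM].
  by apply: rdualP => u /=; rewrite Fcou.
- by move=> a; apply: rdualP => u /=; rewrite -Ft -FM Fcou.
- by move=> a; apply: rdualP => u /=; rewrite Fcou.
- move=> f; apply: rdual_cop_uniq => // u u'.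
  rewrite (sw_comp _ _ (rdual_eval_balanced L u u')) /= FM (rdual_copP basisL').
  apply: eq_tlift => p q; rewrite tlift_tens; last exact: rdual_eval_balanced.
  by rewrite /rdual_eval /= FM Fs.
- by move=> f; rewrite F1.
Qed.

End Transposes.

Section BasisTransfer.
Variables (k : comPzRingType) (A U V : kalgType k).
Variables (L : lbialgebroid A U) (L' : lbialgebroid A V) (F : U -> V) (G : V -> U).
Hypothesis GK : cancel G F.
Hypothesis FP : is_lbialgebroid_morphism L L' F id.
Hypothesis GP : is_lbialgebroid_morphism L' L G id.

Let FB : zmod_morphism F. Proof. by case: FP => -[]. Qed.
Let FM u v : F (u * v) = F u * F v. Proof. by case: FP => -[_ [_ ->]]. Qed.

(** The vectors are pushed forward by [F] and the forms pulled back by [G]. With [F] the antipode,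
    dual bases over [H^l] yield those over the co-opposite of [H^r]. *)
Lemma ldual_basis_transfer : has_ldual_basis L -> has_ldual_basis L'.
Proof.
case=> n [e [f E]]; exists n, (F \o e), (ltranspose GP \o f) => v.
rewrite -[LHS]GK (E (G v)) (big_morph F (zmod_morphismD FB) (zmod_morphism0 FB)).
by apply: eq_bigr => i _; rewrite FM (lmorphism_tgt FP).
Qed.

Lemma rdual_basis_transfer : has_rdual_basis L -> has_rdual_basis L'.
Proof.
case=> n [e [f E]]; exists n, (F \o e), (rtranspose GP \o f) => v.
rewrite -[LHS]GK (E (G v)) (big_morph F (zmod_morphismD FB) (zmod_morphism0 FB)).
by apply: eq_bigr => i _; rewrite FM (lmorphism_src FP).
Qed.
End BasisTransfer.

(** * The Galois map and its naturality *)

Section GaloisMap.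
Variables (k : comPzRingType) (A U : kalgType k) (L : lbialgebroid A U).
Let LP := lbialgebroidP L.

Definition galois_kernel (u v : U) :
    tensor (fun a u => tgt L a * u) (fun a v => src L a * v) :=
  \sw_(u1, u2 <- cop L u) u1 \ot u2 * v.

Lemma galois_kernel_balanced v : balanced (fun a u => tgt L a * u) (fun a v => src L a * v)
  (fun u1 u2 => u1 \ot u2 * v : tensor (fun a u => tgt L a * u) (fun a v => src L a * v)).
Proof.
by split=> *; rewrite ?(mulrDl, tensDl, tensDr) // -mulrA tens_base.
Qed.

Lemma galois_balanced :
  balanced (fun a u => u * tgt L a) (fun a v => tgt L a * v) galois_kernel.
Proof.
rewrite /galois_kernel; split=> [m m' n|m n n'|a m n].
- by rewrite copD tliftD //; exact: galois_kernel_balanced.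
- by rewrite -sw_add; apply: eq_tlift => x y; rewrite mulrDr tensDr.
- rewrite (sw_cop_mul_tgt _ _ (galois_kernel_balanced n)).
  by apply: eq_tlift => x y; rewrite mulrA.
Qed.

(** [translation] picks some preimage by choice; injectivity identifies it with any explicit one. *)
Lemma translationE u x : injective (@galois k A U L) -> galois x = u \ot 1 ->
  translation L u = x.
Proof.
move=> inj xu; apply: inj; rewrite xu.
exact: (classical_sets.xgetPex 0 (ex_intro (fun x => galois x = u \ot 1) x xu)).
Qed.

Lemma dual_antipode_balanced (f : ldual L) :
  balanced (fun a u => u * tgt L a) (fun a v => tgt L a * v)
    (fun v w => cou L (v * tgt L (f w))).
Proof.
split=> *; rewrite ?(mulrDl, mulrDr, ldualD, tgtD, couD) //.
by rewrite -mulrA -tgtM ldual_tgt.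
Qed.
End GaloisMap.

Section GaloisTransport.
Variables (k : comPzRingType) (A U V : kalgType k).
Variables (L : lbialgebroid A U) (L' : lbialgebroid A V).

(* As [bmap], but on the domain of the Galois map. *)
Definition gmap (F : U -> V)
    (x : tensor (fun a u => u * tgt L a) (fun a v => tgt L a * v)) :
    tensor (fun a u => u * tgt L' a) (fun a v => tgt L' a * v) :=
  \sw_(u, v <- x) F u \ot F v.

Variable F : U -> V.
Hypothesis FP : is_lbialgebroid_morphism L L' F id.

Let FM u v : F (u * v) = F u * F v. Proof. by case: FP => -[_ [_ ->]]. Qed.

Lemma gmap_balanced :
  balanced (fun a u => u * tgt L a) (fun a v => tgt L a * v)
    (fun u v => F u \ot F v
       : tensor (fun a u => u * tgt L' a) (fun a v => tgt L' a * v)).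
Proof.
have [[FB _ _] _ _ Ft _ _] := FP; have FD := zmod_morphismD FB.
split=> *; rewrite ?FD ?tensDl ?tensDr // !FM Ft.
exact: (tens_bal (fun a u => u * tgt L' a)).
Qed.

Lemma galois_gmap x : galois (gmap F x) = bmap L L' F (galois x).
Proof.
have Fb := bmap_balanced (lmorphism_algebra FP).
rewrite /bmap (sw_comp _ _ Fb) /galois (sw_comp _ _ (galois_balanced L')).
apply: eq_tlift => m n; rewrite tlift_tens; last exact: galois_balanced.
rewrite /galois_kernel (lmorphism_cop FP) (sw_comp _ _ Fb).
rewrite (sw_comp _ _ (galois_kernel_balanced L' (F n))).
apply: eq_tlift => p q; rewrite !tlift_tens //; last exact: galois_kernel_balanced.
by rewrite FM.
Qed.
End GaloisTransport.

Arguments gmap {k A U V} L L' F x.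

Section AntipodeTransport.
Variables (k : comPzRingType) (A U V : kalgType k).
Variables (L : lbialgebroid A U) (L' : lbialgebroid A V) (F : U -> V) (G : V -> U).
Hypothesis GK : cancel G F.
Hypothesis FP : is_lbialgebroid_morphism L L' F id.
Hypothesis GP : is_lbialgebroid_morphism L' L G id.
Hypothesis inj : injective (@galois k A U L).

Lemma galois_transfer_inj : injective (@galois k A V L').
Proof.
have gK x : gmap L L' F (gmap L' L G x) = x.
  rewrite /gmap (sw_comp _ _ (gmap_balanced FP)) -[RHS]tlift_id.
  by apply: eq_tlift => m n; rewrite tlift_tens ?GK //; exact: gmap_balanced.
move=> x y xy; rewrite -[x]gK -[y]gK; congr (gmap _ _ _ _).
by apply: inj; rewrite !galois_gmap // xy.
Qed.

(** [F] carries the Galois preimage of [u \ot 1] to that of [F u \ot 1], so [S^*] commutes with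
    transposition along [F]. This is the content of the last identity of the theorem. *)
Lemma dual_antipode_transfer (f : ldual L') u x : @galois k A U L x = u \ot 1 ->
  dual_antipode L' f (F u) = dual_antipode L (ltranspose FP f) u.
Proof.
move=> xu; have [F1 FM] : monoid_morphism F by case: FP => -[].
have xFu : galois (gmap L L' F x) = F u \ot 1.
  rewrite galois_gmap // xu /bmap tlift_tens ?F1 //.
  exact: bmap_balanced (lmorphism_algebra FP).
rewrite /dual_antipode (translationE inj xu) (translationE galois_transfer_inj xFu).
rewrite (sw_comp _ _ (dual_antipode_balanced f)); apply: eq_tlift => m n.
rewrite tlift_tens; last exact: dual_antipode_balanced.
by rewrite -(lmorphism_cou FP) FM (lmorphism_tgt FP).
Qed.
End AntipodeTransport.

(** * Hopf algebroids *)

Section HopfAlgebroid.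
Variables (k : comPzRingType) (A B H : kalgType k) (X : hopf_algebroid A B H).

Local Notation L := (hopf_l X).
Local Notation R := (hopf_r X).
Local Notation S := (antipode X).
Local Notation sl := (src L).
Local Notation tl := (tgt L).
Local Notation eps := (cou L).
Local Notation sr := (rsrc R).
Local Notation tr := (rtgt R).
Local Notation balL := (balanced (fun a (u : H) => tl a * u) (fun a (v : H) => sl a * v)).
Local Notation balR := (balanced (fun b (u : H) => u * sr b) (fun b (v : H) => v * tr b)).
Local Notation TL := (tensor (fun a (u : H) => tl a * u) (fun a (v : H) => sl a * v)).
Local Notation TR := (tensor (fun b (u : H) => u * sr b) (fun b (v : H) => v * tr b)).

Let XP := hopf_algebroidP X.
Let LP := lbialgebroidP L.
Let RP := lbialgebroidP R.

(* The right bialgebroid structure, with all products taken in [H] rather than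
   in [H^c]. *)
Definition copr (h : H) : TR := cop R h.
Definition cour (h : H) : B := cou R h.

Lemma sw_copr_mul (G : zmodType) (g : H -> H -> G) u v : balR g ->
  tlift g (copr (u * v))
  = \sw_(u1, u2 <- copr u) \sw_(v1, v2 <- copr v) g (u1 * v1) (u2 * v2).
Proof. exact: (@sw_cop_mul _ _ _ R G g v u). Qed.

Lemma sw_copr_tr (G : zmodType) (g : H -> H -> G) u b : balR g ->
  tlift g (copr (u * tr b)) = \sw_(u1, u2 <- copr u) g (u1 * tr b) u2.
Proof. exact: (@sw_cop_src _ _ _ R G g b u). Qed.

Lemma sw_copr_sr (G : zmodType) (g : H -> H -> G) u b : balR g ->
  tlift g (copr (u * sr b)) = \sw_(u1, u2 <- copr u) g u1 (u2 * sr b).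
Proof. exact: (@sw_cop_tgt _ _ _ R G g b u). Qed.

Lemma sw_copr_trl (G : zmodType) (g : H -> H -> G) b u : balR g ->
  tlift g (copr (tr b * u)) = \sw_(u1, u2 <- copr u) g (tr b * u1) u2.
Proof. exact: (@sw_cop_mul_src _ _ _ R G g b u). Qed.

Lemma sw_copr_srl (G : zmodType) (g : H -> H -> G) b u : balR g ->
  tlift g (copr (sr b * u)) = \sw_(u1, u2 <- copr u) g u1 (sr b * u2).
Proof. exact: (@sw_cop_mul_tgt _ _ _ R G g b u). Qed.

Lemma sw_copr_takeuchi (G : zmodType) (g : H -> H -> G) b u : balR g ->
  \sw_(u1, u2 <- copr u) g (sr b * u1) u2 = \sw_(u1, u2 <- copr u) g u1 (tr b * u2).
Proof. exact: (@sw_cop_takeuchi _ _ _ R G g b u). Qed.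

Lemma copr_coassoc (G : zmodType) (g : H -> H -> H -> G) u :
  balanced3 (fun b (u : H) => u * sr b) (fun b (v : H) => v * tr b)
            (fun b (v : H) => v * sr b) (fun b (w : H) => w * tr b) g ->
  \sw_(u1, u2 <- copr u) \sw_(v, w <- copr u1) g v w u2
  = \sw_(u1, u2 <- copr u) \sw_(v, w <- copr u2) g u1 v w.
Proof. exact: (@cop_coassoc_tlift _ _ _ R G g u). Qed.

Lemma coprB : zmod_morphism copr. Proof. exact: cop_additive RP. Qed.
Lemma coprD u v : copr (u + v) = copr u + copr v. Proof. exact: (@copD _ _ _ R). Qed.
Lemma courB : zmod_morphism cour. Proof. exact: cou_additive RP. Qed.
Lemma courD u v : cour (u + v) = cour u + cour v. Proof. exact: (@couD _ _ _ R). Qed.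
Lemma copr1 : copr 1 = 1 \ot 1. Proof. exact: cop_one RP. Qed.
Lemma copr_srE b : copr (sr b) = 1 \ot sr b. Proof. exact: (@cop_tgtE _ _ _ R). Qed.
Lemma cour1 : cour 1 = 1. Proof. exact: cou_one RP. Qed.
Lemma cour_sr u b : cour (u * sr b) = cour u * b. Proof. exact: (cou_tgt RP). Qed.
Lemma cour_trE b : cour (tr b) = b. Proof. exact: (@cou_srcE _ _ _ R). Qed.
Lemma cour_srE b : cour (sr b) = b. Proof. exact: (@cou_tgtE _ _ _ R). Qed.
Lemma cour_mul_tr u v : cour (u * v) = cour (tr (cour u) * v).
Proof. exact: (cou_mul_src RP). Qed.
Lemma cour_mul_sr u v : cour (u * v) = cour (sr (cour u) * v).
Proof. exact: (cou_mul_tgt RP). Qed.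
Lemma cour_copl u : \sw_(u1, u2 <- copr u) (u2 * tr (cour u1)) = u.
Proof. exact: (cou_copl RP). Qed.
Lemma cour_copr u : \sw_(u1, u2 <- copr u) (u1 * sr (cour u2)) = u.
Proof. exact: (cou_copr RP). Qed.
Lemma srD b c : sr (b + c) = sr b + sr c. Proof. exact: (tgtD R). Qed.
Lemma srM b c : sr (b * c) = sr b * sr c. Proof. exact: (tgtM R). Qed.
Lemma tr1 : tr 1 = 1. Proof. exact: (src1 R). Qed.
Lemma sr1 : sr 1 = 1. Proof. exact: (tgt1 R). Qed.

(** Axiom (1) identifies the image of [s^l] with that of [t^r], and the image of [t^l] with that of
    [s^r]. These four forms let a scalar from [A] be moved by the rules for [B], and conversely. *)
Lemma slE a : sl a = tr (cour (sl a)). Proof. by rewrite [RHS](hopf_rtgt_src XP). Qed.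
Lemma tlE a : tl a = sr (cour (tl a)). Proof. by rewrite [RHS](hopf_rsrc_tgt XP). Qed.
Lemma trE b : tr b = sl (eps (tr b)). Proof. by rewrite [RHS](hopf_src_rtgt XP). Qed.
Lemma srE b : sr b = tl (eps (sr b)). Proof. by rewrite [RHS](hopf_tgt_rsrc XP). Qed.

Lemma mixed_lr (G : zmodType) (g : H -> H -> H -> G) h :
  balanced3 (fun a (u : H) => tl a * u) (fun a (v : H) => sl a * v)
            (fun b (v : H) => v * sr b) (fun b (w : H) => w * tr b) g ->
  \sw_(u, v <- copr h) \sw_(u1, u2 <- cop L u) g u1 u2 v
  = \sw_(u, v <- cop L h) \sw_(v1, v2 <- copr v) g u v1 v2.
Proof.
move=> gb; have := congr1 (tlift3 g) (hopf_coassoc_lr XP h).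
rewrite !(sw_comp3 _ _ _ gb).
under [X in X = _ -> _]eq_tlift => m n do under eq_tlift do rewrite tlift3_tens //.
under [X in _ = X -> _]eq_tlift => m n do under eq_tlift do rewrite tlift3_tens //.
exact.
Qed.

Lemma mixed_rl (G : zmodType) (g : H -> H -> H -> G) h :
  balanced3 (fun b (u : H) => u * sr b) (fun b (v : H) => v * tr b)
            (fun a (v : H) => tl a * v) (fun a (w : H) => sl a * w) g ->
  \sw_(u, v <- cop L h) \sw_(u1, u2 <- copr u) g u1 u2 v
  = \sw_(u, v <- copr h) \sw_(v1, v2 <- cop L v) g u v1 v2.
Proof.
move=> gb; have := congr1 (tlift3 g) (hopf_coassoc_rl XP h).
rewrite !(sw_comp3 _ _ _ gb).
under [X in X = _ -> _]eq_tlift => m n do under eq_tlift do rewrite tlift3_tens //.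
under [X in _ = X -> _]eq_tlift => m n do under eq_tlift do rewrite tlift3_tens //.
exact.
Qed.

(** * The antipode reverses products *)

Lemma antipodeB : zmod_morphism S. Proof. exact: antipode_additive XP. Qed.
Lemma antipodeD u v : S (u + v) = S u + S v. Proof. exact: zmod_morphismD antipodeB _ _. Qed.

Lemma antipode_tl a h : S (tl a * h) = S h * sl a.
Proof. by rewrite -[tl a * h]mulr1 -tr1 (antipode_tgt XP) sr1 mul1r. Qed.

Lemma antipode_tr h b : S (h * tr b) = sr b * S h.
Proof. by rewrite -[h * tr b]mul1r -(tgt1 L) mulrA (antipode_tgt XP) src1 mulr1. Qed.

Lemma antipode_l_balanced : balL (fun h1 h2 => S h1 * h2).
Proof. by split=> *; rewrite ?antipodeD ?mulrDl ?mulrDr // antipode_tl mulrA. Qed.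

Lemma antipode1 : S 1 = 1.
Proof.
have := antipode_l XP 1; rewrite (cop_one LP) tlift_tens; last exact: antipode_l_balanced.
by rewrite mulr1 => ->; rewrite [cou R 1]cour1 sr1.
Qed.

(* [h = t(eps h_2) h_1] *)
Lemma antipode_counit_l h : S h = \sw_(h1, h2 <- cop L h) S h1 * sl (eps h2).
Proof.
rewrite -{1}(cou_copr LP h) (raddf_sw _ _ antipodeB).
by apply: eq_tlift => m n; rewrite antipode_tl.
Qed.

(* [h = h^(2) t^r(partial h^(1))] *)
Lemma antipode_counit_r h : S h = \sw_(h1, h2 <- copr h) sr (cour h1) * S h2.
Proof.
rewrite -{1}(cour_copl h) (raddf_sw _ _ antipodeB).
by apply: eq_tlift => m n; rewrite antipode_tr.
Qed.

Lemma mulrB_morph (c : H) : zmod_morphism (fun x => c * x).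
Proof. by move=> x y; rewrite mulrBr. Qed.

Lemma mulBr_morph (c : H) : zmod_morphism (fun x => x * c).
Proof. by move=> x y; rewrite mulrBl. Qed.

Lemma sw_mull (I : Type) (M N : zmodType) (r : I -> M -> M) (l : I -> N -> N)
    (x : tensor r l) (f : M -> N -> H) c :
  c * tlift f x = \sw_(m, n <- x) c * f m n.
Proof. exact: (raddf_sw _ _ (mulrB_morph c)). Qed.

Lemma sw_mulr (I : Type) (M N : zmodType) (r : I -> M -> M) (l : I -> N -> N)
    (x : tensor r l) (f : M -> N -> H) c :
  tlift f x * c = \sw_(m, n <- x) f m n * c.
Proof. exact: (raddf_sw _ _ (mulBr_morph c)). Qed.

(* Axiom (3) gives [S(t^l(a) h)] and [S(h t^r(b))], but not [S(s^l(a) h)]. *)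
Lemma antipode_sl a h : S (sl a * h) = S h * sr (cour (sl a)).
Proof.
set b := cour (sl a); set c := eps (sr b).
have slb : sl a = tr b by exact: slE.
have src_b : sr b = tl c by exact: srE.
have S3 x y : S (sl a * (tl x * y)) = S (sl a * y) * sl x.
  by rewrite mulrA (src_tgt LP) -mulrA antipode_tl.
(* By axiom (4) the two sides are [sr] of the right counit of [t^r(b) u] and of [s^r(b) u], which
   the right counit does not distinguish. *)
have twist u : \sw_(u1, u2 <- cop L u) S (sl a * u1) * u2
    = \sw_(u1, u2 <- cop L u) S u1 * (tl c * u2).
  rewrite -(sw_cop_src _ _ antipode_l_balanced) -(sw_cop_tgt _ _ antipode_l_balanced).
  rewrite !(antipode_l XP) -!/(cour _) slb -src_b.
  by rewrite cour_mul_tr cour_trE [in RHS]cour_mul_tr cour_srE.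
have E1 : S (sl a * h) = \sw_(h1, h2 <- cop L h) S (sl a * h1) * sl (eps h2).
  rewrite -{1}(cou_copr LP h) sw_mull (raddf_sw _ _ antipodeB).
  by apply: eq_tlift => m n; exact: S3.
rewrite {}E1 [in RHS]antipode_counit_l sw_mulr.
(* Opening [s^l(eps h_(2))] and regrouping puts [S(s^l(a) -)] next to its convolution partner, so
   that [twist] applies; the sum is then closed the same way. *)
transitivity (\sw_(u, w <- copr h) \sw_(u1, u2 <- cop L u) (S (sl a * u1) * u2) * S w).
  rewrite mixed_lr; last first.
    split=> *; rewrite ?(mulrDl, mulrDr, antipodeD) //; last by rewrite antipode_tr !mulrA.
    by rewrite S3 !mulrA.
  apply: eq_tlift => m n; rewrite -(antipode_r XP) sw_mull.
  by apply: eq_tlift => p q; rewrite mulrA.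
transitivity (\sw_(u, w <- copr h) \sw_(u1, u2 <- cop L u) (S u1 * (tl c * u2)) * S w).
  by apply: eq_tlift => m n; rewrite -!sw_mulr twist.
rewrite mixed_lr; last first.
  split=> *; rewrite ?(mulrDl, mulrDr, antipodeD) //; last by rewrite antipode_tr !mulrA.
  by rewrite antipode_tl !mulrA -[_ * sl _ * tl c]mulrA (src_tgt LP) !mulrA.
apply: eq_tlift => m n; rewrite src_b -mulrA (src_tgt LP) -(antipode_r XP) !sw_mull.
by apply: eq_tlift => p q; rewrite !mulrA.
Qed.

Lemma antipode_trl b h : S (tr b * h) = S h * sr b.
Proof. by rewrite trE antipode_sl -trE cour_trE. Qed.

Lemma convolution_balanced u :
  balL (fun v w => \sw_(u1, u2 <- cop L u) S (u1 * v) * (u2 * w)).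
Proof.
split=> [m m' n|m n n'|a m n].
- by rewrite -sw_add; apply: eq_tlift => x y; rewrite mulrDr antipodeD mulrDl.
- by rewrite -sw_add; apply: eq_tlift => x y; rewrite !mulrDr.
pose g x y := S (x * m) * (y * n).
have gb : balL g.
  rewrite /g; split=> *; rewrite ?(mulrDl, mulrDr, antipodeD) //.
  by rewrite -!mulrA antipode_tl !mulrA.
transitivity (\sw_(x, y <- cop L u) g (x * tl a) y).
  by apply: eq_tlift => x y; rewrite /g -[x * _ * _]mulrA.
by rewrite (sw_cop_takeuchi _ _ gb); apply: eq_tlift => x y; rewrite /g -[y * _ * _]mulrA.
Qed.

(* Both sides are convolution inverse to the multiplication of [H]. *)
Lemma antipodeM u v : S (u * v) = S v * S u.
Proof.
(* Summing [K] against [S] over the right coproduct of [u] recovers [S(u c)] ([K1]); summing over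
   the coproduct of [v] produces a right counit ([K2]). Computing one double sum both ways gives the
   identity. *)
pose K c d w := \sw_(u1, u2 <- cop L w) S (u1 * c) * (u2 * d).
have Kb w : balL (fun c d => K c d w) := convolution_balanced w.
have KB c w : zmod_morphism (fun d => K c d w).
  by have [_ D _] := Kb w; move=> x y; apply: (canRL (addrK _)); rewrite -D subrK.
have K1 c : \sw_(w, y <- copr u) K c 1 w * S y = S (u * c).
  under eq_tlift do rewrite sw_mulr.
  rewrite (mixed_lr (g := fun u1 u2 y => S (u1 * c) * (u2 * 1) * S y)); last first.
    split=> *; rewrite ?(mulrDl, mulrDr, antipodeD) //.
      by rewrite -!mulrA antipode_tl !mulrA.
    by rewrite antipode_tr !mulr1 !mulrA.
  rewrite -[in RHS](cou_copr LP u) sw_mulr (raddf_sw _ _ antipodeB).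
  apply: eq_tlift => m n; rewrite -mulrA antipode_tl -(antipode_r XP) sw_mull.
  by apply: eq_tlift => p q; rewrite mulr1 mulrA.
have K2 w : \sw_(v1, v2 <- cop L v) K v1 (sl (eps v2)) w
    = \sw_(v1, v2 <- copr v) sr (cour (w * v1)) * S v2.
  transitivity (\sw_(v', q <- copr v) \sw_(v1, v2 <- cop L v') K v1 (v2 * S q) w).
    rewrite mixed_lr; last first.
      have [b1 b2 b3] := Kb w.
      split=> *; rewrite ?(mulrDl, mulrDr, antipodeD, b1, b2) ?b3 // ?mulrA //.
      by rewrite antipode_tr mulrA.
    apply: eq_tlift => m n; rewrite -(antipode_r XP); exact: raddf_sw (KB _ _).
  apply: eq_tlift => m n; rewrite -(antipode_l XP) (sw_cop_mul _ _ antipode_l_balanced).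
  rewrite sw_mulr; apply: eq_tlift => p q; rewrite sw_mulr.
  by apply: eq_tlift => x y; rewrite !mulrA.
(* The counit of [v] is inserted in [S(u v)]; balancedness of [K] moves [t^l(eps v_(2))] from the
   slot [c] to [s^l(eps v_(2))] in the slot [d], the shape that [K2] expects. *)
transitivity (\sw_(w, y <- copr u) (\sw_(v1, v2 <- cop L v) K v1 (sl (eps v2)) w) * S y).
  rewrite -{1}(cou_copr LP v) sw_mull (raddf_sw _ _ antipodeB).
  under [RHS]eq_tlift do rewrite sw_mulr.
  rewrite sw_exchange; apply: eq_tlift => m n; rewrite -K1; apply: eq_tlift => w y.
  by have [_ _ E] := Kb w; rewrite E mulr1.
rewrite [S u]antipode_counit_r sw_mull; apply: eq_tlift => w y; rewrite K2.
(* Inside the counit [w] may be replaced by [t^r(partial w)], so the inner sum is [S(t^r(partial w)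
   v) = S(v) s^r(partial w)]. *)
rewrite mulrA -antipode_trl [in RHS]antipode_counit_r sw_copr_trl; last first.
  by split=> *; rewrite ?(courD, srD, antipodeD, mulrDl, mulrDr) // cour_sr srM antipode_tr mulrA.
by congr (_ * _); apply: eq_tlift => m n; rewrite -cour_mul_tr.
Qed.

Lemma antipode_tlE a : S (tl a) = sl a.
Proof. by rewrite -[tl a]mulr1 antipode_tl antipode1 mul1r. Qed.

Lemma antipode_srE b : S (sr b) = sl (eps (sr b)).
Proof. by rewrite {1}srE antipode_tlE. Qed.

Lemma antipode_trE b : S (tr b) = sr b.
Proof. by rewrite -[tr b]mul1r antipode_tr antipode1 mulr1. Qed.

Lemma antipode_slE a : S (sl a) = sr (cour (sl a)).
Proof. by rewrite {1}slE antipode_trE. Qed.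

Lemma cour_antipode h : cour (S h) = cour (sl (eps h)).
Proof.
rewrite -(antipode_r XP) (raddf_sw _ _ courB) antipode_counit_r (raddf_sw _ _ courB).
by apply: eq_tlift => m n; rewrite [RHS]cour_mul_sr.
Qed.

Lemma tl_cou_antipode h : tl (eps (S h)) = sr (cour h).
Proof.
rewrite [RHS]srE; congr tl.
rewrite -(antipode_l XP) antipode_counit_l !(raddf_sw _ _ (cou_additive LP)).
by apply: eq_tlift => m n; rewrite [RHS](cou_mul_src LP).
Qed.

(** * The antipode reverses coproducts *)

Lemma tens_sr b u v : u * sr b \ot v = u \ot v * tr b :> TR.
Proof. exact: (@tens_bal _ _ _ (fun b u => u * sr b) (fun b v => v * tr b)). Qed.

Lemma tens_nu a u v : u * sr (cour (sl a)) \ot v = u \ot v * sl a :> TR.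
Proof. by rewrite tens_sr -slE. Qed.

Definition antipode_flip_r (h : H) : TR := \sw_(h1, h2 <- cop L h) S h2 \ot S h1.

Lemma antipode_flip_r_balanced x1 x2 :
  balL (fun h1 h2 => x1 * S h2 \ot x2 * S h1 : TR).
Proof.
split=> *; rewrite ?(antipodeD, mulrDr, tensDl, tensDr) //.
by rewrite antipode_tl antipode_sl !mulrA tens_nu.
Qed.

(** The product of [Delta_r(t)] with [antipode_flip_r y]. Factorwise multiplication is not well
    defined on the whole tensor product, hence an iterated sum; the Takeuchi condition for [y]
    balances it in the legs of [t]. *)
Definition cop_mul_flip_r (t y : H) : TR :=
  \sw_(t1, t2 <- copr t) \sw_(y1, y2 <- cop L y) t1 * S y2 \ot t2 * S y1.

Lemma cop_mul_flip_r_kernel y :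
  balR (fun t1 t2 => \sw_(y1, y2 <- cop L y) t1 * S y2 \ot t2 * S y1 : TR).
Proof.
split=> [m m' n|m n n'|b m n].
- by rewrite -sw_add; apply: eq_tlift => p q; rewrite mulrDl tensDl.
- by rewrite -sw_add; apply: eq_tlift => p q; rewrite mulrDl tensDr.
have fb := antipode_flip_r_balanced m n.
transitivity (\sw_(y1, y2 <- cop L y) m * S (y2 * sl (eps (tr b))) \ot n * S y1 : TR).
  by apply: eq_tlift => p q; rewrite -trE antipode_tr mulrA.
rewrite -(sw_cop_takeuchi _ _ fb); apply: eq_tlift => p q.
by rewrite antipodeM antipode_tlE -trE mulrA.
Qed.

Lemma cop_mul_flip_r_addl t t' y :
  cop_mul_flip_r (t + t') y = cop_mul_flip_r t y + cop_mul_flip_r t' y.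
Proof. by rewrite /cop_mul_flip_r coprD tliftD //; exact: cop_mul_flip_r_kernel. Qed.

Lemma cop_mul_flip_r_addr t y y' :
  cop_mul_flip_r t (y + y') = cop_mul_flip_r t y + cop_mul_flip_r t y'.
Proof.
rewrite /cop_mul_flip_r -sw_add; apply: eq_tlift => p q.
by rewrite copD tliftD //; exact: antipode_flip_r_balanced.
Qed.

Lemma cop_mul_flip_r_sr t y b : cop_mul_flip_r (t * sr b) y = cop_mul_flip_r t (y * tr b).
Proof.
rewrite /cop_mul_flip_r (sw_copr_sr _ _ (cop_mul_flip_r_kernel y)).
apply: eq_tlift => p q; rewrite trE (sw_cop_mul_src _ _ (antipode_flip_r_balanced p q)).
by apply: eq_tlift => y1 y2; rewrite -trE antipode_tr mulrA.
Qed.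

(** The flip is a right convolution inverse of [Delta_r]. Coassociativity joins the factors of the
    second leg, which cancel to a scalar; that scalar crosses the tensor sign and completes a counit
    inside [S], after which the first leg cancels. *)
Lemma sw_cop_mul_flip_r w :
  \sw_(x, y <- copr w) cop_mul_flip_r x y = sl (eps w) \ot 1.
Proof.
pose g x1 x2 y : TR := \sw_(y1, y2 <- cop L y) x1 * S y2 \ot x2 * S y1.
transitivity (\sw_(x, y <- copr w) \sw_(y', z <- copr y) g x y' z).
  rewrite -copr_coassoc //.
  split=> [m m' n p|m n n' p|m n p p'|b m n p|b m n p].
  - by have [E _ _] := cop_mul_flip_r_kernel p; exact: E.
  - by have [_ E _] := cop_mul_flip_r_kernel p; exact: E.
  - by rewrite /g copD tliftD //; exact: antipode_flip_r_balanced.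
  - by have [_ _ E] := cop_mul_flip_r_kernel p; exact: E.
  rewrite /g [in RHS]trE (sw_cop_mul_src _ _ (antipode_flip_r_balanced m n)).
  by apply: eq_tlift => y1 y2; rewrite -trE antipode_tr mulrA.
transitivity (\sw_(x, y <- copr w) (x * S y \ot 1 : TR)); last first.
  have tB : zmod_morphism (fun h => h \ot 1 : TR).
    by move=> p q; apply: (canRL (addrK _)); rewrite -tensDl subrK.
  by rewrite -(antipode_r XP) (raddf_sw _ _ tB).
apply: eq_tlift => x y; rewrite /g -mixed_rl; last first.
  split=> *; rewrite ?(antipodeD, mulrDr, mulrDl, tensDl, tensDr) //.
    by rewrite antipode_tr mulrA.
  by rewrite antipode_tl antipode_sl !mulrA tens_nu.
have tB : zmod_morphism (fun h => x * S h \ot 1 : TR).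
  move=> p q; apply: (canRL (addrK _)); rewrite -tensDl -mulrDr -antipodeD subrK //.
rewrite -[in RHS](cou_copl LP y) (raddf_sw _ _ tB); apply: eq_tlift => u v.
have uB : zmod_morphism (fun h => x * S v \ot h : TR).
  by move=> p q; apply: (canRL (addrK _)); rewrite -tensDr subrK.
by rewrite -(raddf_sw _ _ uB) (antipode_r XP) antipode_sl mulrA tens_nu mul1r.
Qed.

(* [Delta_r S] and [antipode_flip_r] are both convolution inverse to [Delta_r]. *)
Lemma copr_antipode h : copr (S h) = antipode_flip_r h.
Proof.
pose lm (s1 s2 y z : H) : TR := s1 * y \ot s2 * z.
have lmb s1 s2 : balR (lm s1 s2).
  by rewrite /lm; split=> *; rewrite ?(mulrDr, tensDl, tensDr) // !mulrA tens_sr.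
(* Multiplication by [Delta_r(t)] on the left: [s^l(eps w) \ot 1] is absorbed by [t], since
   [s^l(A) = t^r(B)] acts on the first leg of [Delta_r]. *)
have cm t w : \sw_(x, y <- copr w) cop_mul_flip_r (t * x) y = copr (t * sl (eps w)).
  transitivity (\sw_(t1, t2 <- copr t) tlift (lm t1 t2) (sl (eps w) \ot 1 : TR)).
    under [RHS]eq_tlift do rewrite -sw_cop_mul_flip_r (sw_comp _ _ (lmb _ _)).
    rewrite [RHS]sw_exchange; apply: eq_tlift => x y.
    rewrite {1}/cop_mul_flip_r (sw_copr_mul _ _ (cop_mul_flip_r_kernel y)).
    apply: eq_tlift => t1 t2; rewrite (sw_comp _ _ (lmb _ _)); apply: eq_tlift => x1 x2.
    rewrite (sw_comp _ _ (lmb _ _)); apply: eq_tlift => y1 y2.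
    by rewrite tlift_tens // /lm !mulrA.
  rewrite -[RHS]tlift_id slE (sw_copr_tr _ _ (tens_balanced _ _)) -slE.
  by apply: eq_tlift => t1 t2; rewrite tlift_tens // /lm mulr1.
rewrite {1}antipode_counit_l (raddf_sw _ _ coprB).
under eq_tlift do rewrite -cm.
(* Regrouping pairs [S u] with its partner [x]; axiom (4) leaves a scalar [s^r], which moves onto
   [y] as a factor [t^r] and completes the right counit of [h]. *)
rewrite -(mixed_lr (g := fun u x y => cop_mul_flip_r (S u * x) y)); last first.
  split=> *; rewrite ?(antipodeD, mulrDl, mulrDr, cop_mul_flip_r_addl, cop_mul_flip_r_addr) //.
    by rewrite antipode_tl mulrA.
  by rewrite mulrA cop_mul_flip_r_sr.
have flip_b : balL (fun h1 h2 => S h2 \ot S h1 : TR).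
  split=> *; rewrite ?(antipodeD, tensDl, tensDr) //.
  by rewrite antipode_tl antipode_sl tens_nu.
have flipB : zmod_morphism antipode_flip_r.
  move=> p q; rewrite /antipode_flip_r (cop_additive LP); apply: tlift_additive.
  exact: flip_b.
rewrite -[in RHS](cour_copl h) (raddf_sw _ _ flipB); apply: eq_tlift => x y.
have cB : zmod_morphism (fun t => cop_mul_flip_r t y).
  by move=> p q; apply: (canRL (addrK _)); rewrite -cop_mul_flip_r_addl subrK.
rewrite -(raddf_sw _ _ cB) (antipode_l XP) /cop_mul_flip_r copr_srE tlift_tens; last first.
  exact: cop_mul_flip_r_kernel.
rewrite /antipode_flip_r [tr (cour x)]trE (sw_cop_mul_src _ _ flip_b) -trE.
by apply: eq_tlift => y1 y2; rewrite mul1r antipode_tr.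
Qed.

(** The counterpart for [Delta_l]. That [S] is a morphism rests on the formula for [Delta_r S]; the
    one for [Delta_l S] serves [dual_actM]. *)
Definition antipode_flip_l (h : H) : TL := \sw_(h1, h2 <- copr h) S h2 \ot S h1.

Lemma antipode_flip_l_balanced t1 t2 :
  balR (fun h1 h2 => S h2 * t1 \ot S h1 * t2 : TL).
Proof.
split=> *; rewrite ?(antipodeD, mulrDl, tensDl, tensDr) //.
by rewrite antipodeM antipode_srE antipode_tr -!mulrA -tens_base -srE !mulrA.
Qed.

Definition flip_l_mul_cop (x t : H) : TL :=
  \sw_(t1, t2 <- cop L t) \sw_(x1, x2 <- copr x) S x2 * t1 \ot S x1 * t2.

Lemma flip_l_mul_cop_kernel x :
  balL (fun t1 t2 => \sw_(x1, x2 <- copr x) S x2 * t1 \ot S x1 * t2 : TL).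
Proof.
split=> [m m' n|m n n'|a m n].
- by rewrite -sw_add; apply: eq_tlift => p q; rewrite mulrDr tensDl.
- by rewrite -sw_add; apply: eq_tlift => p q; rewrite mulrDr tensDr.
have fb := antipode_flip_l_balanced m n.
transitivity (\sw_(x1, x2 <- copr x) S (tr (cour (tl a)) * x2) * m \ot S x1 * n : TL).
  by apply: eq_tlift => p q; rewrite antipode_trl -tlE mulrA.
rewrite -(sw_copr_takeuchi _ _ fb); apply: eq_tlift => p q.
by rewrite -tlE antipode_tl mulrA.
Qed.

Lemma flip_l_mul_cop_addr x t t' :
  flip_l_mul_cop x (t + t') = flip_l_mul_cop x t + flip_l_mul_cop x t'.
Proof. by rewrite /flip_l_mul_cop copD tliftD //; exact: flip_l_mul_cop_kernel. Qed.

Lemma flip_l_mul_cop_addl x x' t :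
  flip_l_mul_cop (x + x') t = flip_l_mul_cop x t + flip_l_mul_cop x' t.
Proof.
rewrite /flip_l_mul_cop -sw_add; apply: eq_tlift => p q.
by rewrite coprD tliftD //; exact: antipode_flip_l_balanced.
Qed.

Lemma flip_l_mul_cop_tl x t a : flip_l_mul_cop (tl a * x) t = flip_l_mul_cop x (sl a * t).
Proof.
rewrite /flip_l_mul_cop (sw_cop_src _ _ (flip_l_mul_cop_kernel x)).
apply: eq_tlift => p q; rewrite tlE (sw_copr_srl _ _ (antipode_flip_l_balanced p q)).
by apply: eq_tlift => x1 x2; rewrite -tlE antipode_tl mulrA.
Qed.

(** Mirror of [sw_cop_mul_flip_r]: the flip is a left convolution inverse of [Delta_l], the unit is
    [s^r partial], and the first leg cancels before the second. *)
Lemma sw_flip_l_mul_cop w :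
  \sw_(x, y <- cop L w) flip_l_mul_cop x y = 1 \ot sr (cour w).
Proof.
pose g x y1 y2 : TL := \sw_(x1, x2 <- copr x) S x2 * y1 \ot S x1 * y2.
transitivity (\sw_(x, y <- cop L w) \sw_(x', z <- cop L x) g x' z y).
  rewrite cop_coassoc_tlift //.
  split=> [m m' n p|m n n' p|m n p p'|b m n p|b m n p].
  - by rewrite /g coprD tliftD //; exact: antipode_flip_l_balanced.
  - by have [E _ _] := flip_l_mul_cop_kernel m; exact: E.
  - by have [_ E _] := flip_l_mul_cop_kernel m; exact: E.
  - rewrite /g tlE (sw_copr_srl _ _ (antipode_flip_l_balanced n p)).
    by apply: eq_tlift => y1 y2; rewrite -tlE antipode_tl mulrA.
  - by have [_ _ E] := flip_l_mul_cop_kernel m; exact: E.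
have tB : zmod_morphism (fun h => 1 \ot h : TL).
  by move=> p q; apply: (canRL (addrK _)); rewrite -tensDr subrK.
transitivity (\sw_(x, y <- cop L w) (1 \ot S x * y : TL)); last first.
  by rewrite -(antipode_l XP) (raddf_sw _ _ tB).
apply: eq_tlift => x y; rewrite /g.
rewrite (mixed_rl (g := fun x1 x2 z => S x2 * z \ot S x1 * y : TL)); last first.
  split=> *; rewrite ?(antipodeD, mulrDr, mulrDl, tensDl, tensDr) //.
    by rewrite antipodeM antipode_srE antipode_tr -!mulrA -tens_base -srE !mulrA.
  by rewrite antipode_tl mulrA.
have SB : zmod_morphism (fun h => 1 \ot S h * y : TL).
  by move=> p q; apply: (canRL (addrK _)); rewrite -tensDr -mulrDl -antipodeD subrK.
rewrite -[in RHS](cour_copr x) (raddf_sw _ _ SB); apply: eq_tlift => u v.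
have uB : zmod_morphism (fun h => h \ot S u * y : TL).
  by move=> p q; apply: (canRL (addrK _)); rewrite -tensDl subrK.
rewrite -(raddf_sw _ _ uB) (antipode_l XP) -/(cour v) antipodeM antipode_srE.
by rewrite -mulrA -tens_base -srE mulr1.
Qed.

(* [Delta_l S] and [antipode_flip_l] are both convolution inverse to [Delta_l]. *)
Lemma cop_antipode h : cop L (S h) = antipode_flip_l h.
Proof.
pose rm (s1 s2 y z : H) : TL := y * s1 \ot z * s2.
have rmb s1 s2 : balL (rm s1 s2).
  by rewrite /rm; split=> *; rewrite ?(mulrDl, tensDl, tensDr) // -!mulrA tens_base.
have cm t w : \sw_(x, y <- cop L w) flip_l_mul_cop x (y * t) = cop L (sr (cour w) * t).
  transitivity (\sw_(t1, t2 <- cop L t) tlift (rm t1 t2) (1 \ot sr (cour w) : TL)).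
    under [RHS]eq_tlift do rewrite -sw_flip_l_mul_cop (sw_comp _ _ (rmb _ _)).
    rewrite [RHS]sw_exchange; apply: eq_tlift => x y.
    rewrite {1}/flip_l_mul_cop (sw_cop_mul _ _ (flip_l_mul_cop_kernel x)).
    apply: eq_tlift => t1 t2; rewrite (sw_comp _ _ (rmb _ _)); apply: eq_tlift => x1 x2.
    rewrite (sw_comp _ _ (rmb _ _)); apply: eq_tlift => y1 y2.
    by rewrite tlift_tens // /rm !mulrA.
  rewrite -[RHS]tlift_id [sr (cour w)]srE (sw_cop_tgt _ _ (tens_balanced _ _)) -srE.
  by apply: eq_tlift => t1 t2; rewrite tlift_tens // /rm mul1r.
rewrite {1}antipode_counit_r (raddf_sw _ _ (cop_additive LP)).
under eq_tlift do rewrite -cm.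
rewrite (mixed_lr (g := fun x y z => flip_l_mul_cop x (y * S z))); last first.
  split=> *; rewrite ?(antipodeD, mulrDl, mulrDr, flip_l_mul_cop_addl, flip_l_mul_cop_addr) //.
    by rewrite -mulrA flip_l_mul_cop_tl.
  by rewrite antipode_tr mulrA.
have flip_b : balR (fun h1 h2 => S h2 \ot S h1 : TL).
  split=> *; rewrite ?(antipodeD, tensDl, tensDr) //.
  by rewrite antipodeM antipode_srE antipode_tr -tens_base -srE.
have flipB : zmod_morphism antipode_flip_l.
  move=> p q; rewrite /antipode_flip_l coprB; exact: tlift_additive.
rewrite -[in RHS](cou_copr LP h) (raddf_sw _ _ flipB); apply: eq_tlift => x y.
have cB : zmod_morphism (fun t => flip_l_mul_cop x t).
  by move=> p q; apply: (canRL (addrK _)); rewrite -flip_l_mul_cop_addr subrK.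
rewrite -(raddf_sw _ _ cB) (antipode_r XP) /flip_l_mul_cop cop_srcE tlift_tens; last first.
  exact: flip_l_mul_cop_kernel.
rewrite /antipode_flip_l [tl (eps y)]tlE (sw_copr_srl _ _ flip_b) -tlE.
by apply: eq_tlift => y1 y2; rewrite mulr1 antipode_tl.
Qed.

Local Notation K := (hopf_r_op_coop X).

Lemma antipode_lmorphism : @is_lbialgebroid_morphism _ _ H _ H^c L K S id.
Proof.
split=> //=.
- split=> [u v||c]; [exact: antipodeB| |].
    by split=> [|u v]; [exact: antipode1 | exact: antipodeM].
  by rewrite -[LHS](congr1 S (mulr1 _)) (antipode_scal XP) antipode1 mulr1.
- by move=> a; exact: antipode_slE.
- by move=> a; rewrite antipode_tlE; exact: slE.
- move=> h; rewrite -[cop R (S h)]/(copr (S h)) copr_antipode.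
  rewrite /antipode_flip_r.
  pose f (h2 h1 : H) : tensor (fun a (u : H^c) => tgt K a * u)
    (fun a (v : H^c) => src K a * v) := h1 \ot h2.
  have fb : balR f.
    by rewrite /f; exact: (@flip_balanced _ _ _ _ R _ _ (@hopf_nu_invK _ _ _ _ X)).
  rewrite (sw_comp _ _ fb); apply: eq_tlift => h1 h2.
  by rewrite tlift_tens.
- by move=> h; rewrite -[cou R _]/(cour (S h)) cour_antipode; exact: hopf_nuK.
Qed.

(** * The inverse Galois map and the operators [T_f] *)

Local Notation TG := (tensor (fun a (u : H) => u * tl a) (fun a (v : H) => tl a * v)).

Lemma tens_tl a u v : u * tl a \ot v = u \ot tl a * v :> TG.
Proof. exact: (@tens_bal _ _ _ (fun a u => u * tl a) (fun a v => tl a * v)). Qed.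

Lemma translation_balanced v : balR (fun x y => x \ot S y * v : TG).
Proof.
split=> *; rewrite ?(antipodeD, mulrDl, tensDl, tensDr) //.
by rewrite antipode_tr -mulrA [in RHS]srE -tens_tl -srE.
Qed.

Definition galois_inv (z : TL) : TG :=
  \sw_(u, v <- z) \sw_(x, y <- copr u) x \ot S y * v.

Lemma galois_inv_balanced :
  balL (fun u v => \sw_(x, y <- copr u) x \ot S y * v : TG).
Proof.
split=> [m m' n|m n n'|a m n].
- by rewrite coprD tliftD //; exact: translation_balanced.
- by rewrite -sw_add; apply: eq_tlift => p q; rewrite mulrDr tensDr.
- rewrite tlE (sw_copr_srl _ _ (translation_balanced n)) -tlE.
  by apply: eq_tlift => p q; rewrite antipode_tl mulrA.
Qed.

(** Mixed coassociativity pairs [S] with the leg to its right; axiom (4) leaves a scalar that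
    crosses to the first leg and completes the right counit. The lemma serves as injectivity, while
    [galois_translation] supplies the explicit preimage. *)
Lemma galoisK : cancel (@galois k A H L) galois_inv.
Proof.
move=> z; rewrite /galois_inv /galois (sw_comp _ _ galois_inv_balanced) -[RHS]tlift_id.
apply: eq_tlift => u v; rewrite (sw_comp _ _ galois_inv_balanced).
transitivity (\sw_(u1, u2 <- cop L u) \sw_(x, y <- copr u1) x \ot S y * (u2 * v) : TG).
  by apply: eq_tlift => u1 u2; rewrite tlift_tens //; exact: galois_inv_balanced.
rewrite (mixed_rl (g := fun x y z => x \ot S y * (z * v) : TG)); last first.
  split=> *; rewrite ?(antipodeD, mulrDr, mulrDl, tensDl, tensDr) //.
    by rewrite antipode_tr -mulrA [in RHS]srE -tens_tl -srE.
  by rewrite antipode_tl !mulrA.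
have vB : zmod_morphism (fun h => h \ot v : TG).
  by move=> p q; apply: (canRL (addrK _)); rewrite -tensDl subrK.
rewrite -[in RHS](cour_copr u) (raddf_sw _ _ vB); apply: eq_tlift => x y.
have xB : zmod_morphism (fun h => x \ot h * v : TG).
  by move=> p q; apply: (canRL (addrK _)); rewrite -tensDr -mulrDl subrK.
under eq_tlift do rewrite mulrA.
by rewrite -(raddf_sw _ _ xB) (antipode_l XP) -/(cour y) srE tens_tl.
Qed.

Definition translation_of (u : H) : TG := \sw_(x, y <- copr u) x \ot S y.

Lemma galois_translation u : galois (translation_of u) = u \ot 1.
Proof.
rewrite /translation_of /galois (sw_comp _ _ (galois_balanced L)).
transitivity (\sw_(x, y <- copr u) \sw_(x1, x2 <- cop L x) x1 \ot x2 * S y : TL).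
  by apply: eq_tlift => x y; rewrite tlift_tens //; exact: galois_balanced.
rewrite (mixed_lr (g := fun x y z => x \ot y * S z : TL)); last first.
  split=> *; rewrite ?(antipodeD, mulrDr, mulrDl, tensDl, tensDr) //.
    by rewrite tens_base mulrA.
  by rewrite antipode_tr mulrA.
have oB : zmod_morphism (fun h => h \ot 1 : TL).
  by move=> p q; apply: (canRL (addrK _)); rewrite -tensDl subrK.
rewrite -[in RHS](cou_copr LP u) (raddf_sw _ _ oB); apply: eq_tlift => x y.
have xB : zmod_morphism (fun h => x \ot h : TL).
  by move=> p q; apply: (canRL (addrK _)); rewrite -tensDr subrK.
by rewrite -(raddf_sw _ _ xB) (antipode_r XP) tens_base mulr1.
Qed.

Lemma translation_hopf u : translation L u = translation_of u.
Proof. exact: translationE (can_inj galoisK) (galois_translation u). Qed.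

(* [h_+ t(f(h_-))]: the operator [T_f] of the header. *)
Definition dual_act (f : ldual L) (h : H) : H := \sw_(x, y <- copr h) x * tl (f (S y)).

Lemma dual_act_balanced (f : ldual L) : balR (fun x y => x * tl (f (S y))).
Proof.
split=> *; rewrite ?(antipodeD, ldualD, tgtD, mulrDl, mulrDr) //.
by rewrite antipode_tr srE ldual_tgt tgtM mulrA.
Qed.

Lemma dual_actB (f : ldual L) : zmod_morphism (dual_act f).
Proof.
move=> u v; rewrite /dual_act coprB; apply: tlift_additive.
exact: dual_act_balanced.
Qed.

Lemma dual_act_sl (f : ldual L) a h : dual_act f (sl a * h) = sl a * dual_act f h.
Proof.
rewrite /dual_act [sl a]slE (sw_copr_trl _ _ (dual_act_balanced f)) -slE sw_mull.
by apply: eq_tlift => x y; rewrite mulrA.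
Qed.

Lemma dual_act_mul_tl (f : ldual L) h a :
  dual_act f (h * tl a) = \sw_(x, y <- copr h) x * tl (f (sl a * S y)).
Proof.
rewrite /dual_act [tl a]tlE (sw_copr_sr _ _ (dual_act_balanced f)) -tlE.
by apply: eq_tlift => x y; rewrite antipodeM antipode_tlE.
Qed.

Lemma dual_act_mul_sl (f : ldual L) h a :
  dual_act f (h * sl a) = \sw_(x, y <- copr h) x * sl a * tl (f (S y)).
Proof.
by rewrite /dual_act [sl a]slE (sw_copr_tr _ _ (dual_act_balanced f)) -slE.
Qed.

(** The Takeuchi condition of [Delta_r] trades [s^r(b) = t^l(c)] before the first leg for [t^r(b)]
    before the second, which [S] turns into [s^r(b)] on the right. *)
Lemma tl_dual_act (f : ldual L) c h :
  \sw_(x, y <- copr h) x * tl (f (S y * tl c)) = tl c * dual_act f h.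
Proof.
rewrite sw_mull; transitivity (\sw_(x, y <- copr h) x * tl (f (S (tr (cour (tl c)) * y)))).
  by apply: eq_tlift => x y; rewrite antipode_trl -tlE.
rewrite -(sw_copr_takeuchi _ _ (dual_act_balanced f)) -tlE.
by apply: eq_tlift => x y; rewrite mulrA.
Qed.

(** Since [Delta_l(S z) = S z^(2) \ot S z^(1)], the value of [f * g] at [S z] is
    [g(s(f(S z^(2))) S z^(1))]; coassociativity of [Delta_r] then lets [T_f] act first. *)
Lemma dual_actM (f g : ldual L) h : dual_act (f * g) h = dual_act g (dual_act f h).
Proof.
pose G x1 x2 y := x1 * tl (g (sl (f (S y)) * S x2)).
have Gb : balanced3 (fun b (u : H) => u * sr b) (fun b (v : H) => v * tr b)
            (fun b (v : H) => v * sr b) (fun b (w : H) => w * tr b) G.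
  rewrite /G; split=> *; rewrite ?(antipodeD, ldualD, srcD, tgtD, mulrDl, mulrDr) //.
    by rewrite antipode_tr srE mulrA (src_tgt LP) -[in RHS]mulrA ldual_tgt tgtM mulrA.
  by rewrite antipodeM antipode_srE antipode_tr [in RHS]srE ldual_tgt srcM !mulrA.
rewrite [dual_act f h]/dual_act (raddf_sw _ _ (dual_actB g)).
under [RHS]eq_tlift do rewrite dual_act_mul_tl.
rewrite [RHS](copr_coassoc _ Gb); apply: eq_tlift => x z.
have tB : zmod_morphism (fun a => x * tl a) by move=> p q; rewrite tgtB mulrBr.
rewrite -(raddf_sw _ _ tB) /= cop_antipode (sw_comp _ _ (ldual_balanced f g)).
congr (x * tl _); apply: eq_tlift => u v.
by rewrite tlift_tens //; exact: ldual_balanced.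
Qed.

Lemma dual_act_target a h : dual_act (ldual_target L a) h = h * tl a.
Proof.
rewrite -[in RHS](cour_copr h) sw_mulr; apply: eq_tlift => x y /=.
by rewrite tgtM tl_cou_antipode mulrA.
Qed.

Lemma dual_act1 h : dual_act 1 h = h.
Proof.
rewrite -[in RHS](cour_copr h); apply: eq_tlift => x y.
by rewrite -tl_cou_antipode.
Qed.

(** * [S^*] as a morphism of right bialgebroids *)

Program Definition hopf_dual_antipode (f : ldual L) : rdual L :=
  @RDual _ _ _ L (fun h => eps (dual_act f h)) _ _.
Next Obligation. by move=> f u v /=; rewrite dual_actB (cou_additive LP). Qed.
Next Obligation. by move=> f a h /=; rewrite dual_act_sl (cou_src LP). Qed.

Local Notation Sl := hopf_dual_antipode.

Lemma hopf_dual_antipodeE f h : Sl f h = dual_antipode L f h.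
Proof.
rewrite /dual_antipode translation_hopf (sw_comp _ _ (dual_antipode_balanced f)) /=.
rewrite (raddf_sw _ _ (cou_additive LP)); apply: eq_tlift => x y.
by rewrite tlift_tens //; exact: dual_antipode_balanced.
Qed.

(** Mixed coassociativity moves the left coproduct onto [h^(1)]; as right multiplication by [t(a)]
    affects only the second leg of [Delta_l], the counit reassembles [h^(1) t(f(S h^(2)))]. *)
Lemma sw_cop_dual_antipode f h :
  \sw_(u1, u2 <- cop L h) tl (Sl f u2) * u1 = dual_act f h.
Proof.
pose G x y z := tl (eps (y * tl (f (S z)))) * x.
have Gb : balanced3 (fun a (u : H) => tl a * u) (fun a (v : H) => sl a * v)
            (fun b (v : H) => v * sr b) (fun b (w : H) => w * tr b) G.
  rewrite /G; split=> *; rewrite ?(antipodeD, ldualD, tgtD, couD, mulrDl, mulrDr) //.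
    by rewrite -[in RHS]mulrA (cou_src LP) tgtM mulrA.
  by rewrite antipode_tr [in RHS]srE ldual_tgt tgtM -srE mulrA.
transitivity (\sw_(u1, u2 <- cop L h) \sw_(y, z <- copr u2) G u1 y z).
  apply: eq_tlift => x y.
  have tB : zmod_morphism (fun w => tl (eps w) * x).
    by move=> p q; rewrite (cou_additive LP) tgtB mulrBl.
  by rewrite -(raddf_sw _ _ tB).
rewrite -(mixed_lr _ Gb); apply: eq_tlift => x y.
rewrite -[in RHS](cou_copr LP (x * tl (f (S y)))) sw_cop_mul_tgt //.
by split=> *; rewrite ?(couD, tgtD, mulrDl, mulrDr) // (cou_src LP) tgtM mulrA.
Qed.

Lemma hopf_dual_antipodeM f g : Sl (f * g) = Sl f * Sl g.
Proof.
apply: rdualP => h /=; rewrite dual_actM -(sw_cop_dual_antipode f).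
by rewrite (raddf_sw _ _ (dual_actB g)) (raddf_sw _ _ (cou_additive LP)).
Qed.

(** [S] reverses [u u'], so [p] meets [S u'] and [q] meets [S u]: exactly the interchange of legs
    between the pairings of [ldual] and [rdual]. *)
Lemma hopf_dual_antipode_mul (f : ldual L) u u' (z : tensor
    (fun a (g : (ldual L)^c) => (ldual_source L a : (ldual L)^c) * g)
    (fun a (g : (ldual L)^c) => (ldual_target L a : (ldual L)^c) * g)) :
  (forall v v', f (v * v') = tlift (ldual_eval v v') z) ->
  Sl f (u * u') = \sw_(p, q <- z) (Sl q) (u * sl (Sl p u')).
Proof.
move=> fz.
transitivity (\sw_(p, q <- z) eps (\sw_(x, y <- copr u) \sw_(x', y' <- copr u')
    x * x' * tl ((p : ldual L) (S y' * tl ((q : ldual L) (S y)))))).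
  have eB := cou_additive LP.
  rewrite -(raddf_sw _ _ eB) [LHS]/=; congr eps.
  rewrite /dual_act (sw_copr_mul _ _ (dual_act_balanced f)) [RHS]sw_exchange.
  apply: eq_tlift => x y; rewrite [RHS]sw_exchange; apply: eq_tlift => x' y'.
  have tB : zmod_morphism (fun a => x * x' * tl a) by move=> p q; rewrite tgtB mulrBr.
  by rewrite antipodeM fz (raddf_sw _ _ tB).
apply: eq_tlift => p q; rewrite [RHS]/= dual_act_mul_sl.
have eB := cou_additive LP; rewrite (raddf_sw _ _ eB) [RHS](raddf_sw _ _ eB).
apply: eq_tlift => x y; rewrite -[RHS]/(eps (x * sl (eps (dual_act p u')) * tl (q (S y)))).
(* Under the counit [s^l(eps T_p(u'))] may be replaced by [T_p(u')]; [tl_dual_act] then moves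
   [t^l(q(S y))] into the argument of [p]. *)
rewrite -[in RHS]mulrA (src_tgt LP) mulrA -(cou_mul_src LP) -[in RHS]mulrA.
rewrite -tl_dual_act sw_mull.
by congr eps; apply: eq_tlift => x' y'; rewrite mulrA.
Qed.

Hypotheses (basis_l : has_ldual_basis L) (basis_r : has_rdual_basis L).

Lemma hopf_dual_antipode_morphism :
  is_rbialgebroid_morphism (ldual_bialgebroid L) (rdual_bialgebroid L) Sl id.
Proof.
have Slt a : Sl (ldual_target L a) = rdual_target L a.
  by apply: rdualP => h /=; rewrite dual_act_target.
split=> //=.
- split=> [f g||c].
  + apply: rdualP => h /=; rewrite -(cou_additive LP) /dual_act; congr eps.
    apply/eqP; rewrite eq_sym subr_eq -sw_add; apply/eqP; apply: eq_tlift => x y.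
    by rewrite -mulrDr -tgtD subrK.
  + split; last by move=> f g; exact: hopf_dual_antipodeM.
    by apply: rdualP => h /=; rewrite dual_act1.
  + rewrite -[LHS]/(Sl (ldual_target L (scal c))) Slt; apply: rdualP => h /=.
    by rewrite tgtZ -scalC -(tgtZ L) (cou_tgt LP).
- move=> a; apply: rdualP => h /=; rewrite /dual_act.
  transitivity (eps (\sw_(x, y <- copr h) x * S y * sl a)).
    rewrite !(raddf_sw _ _ (cou_additive LP)); apply: eq_tlift => x y.
    by rewrite -(cou_mul_tgt LP) mulrA.
  by rewrite -sw_mulr (antipode_r XP) (cou_src LP) cou_srcE.
- move=> f; apply: rdual_cop_uniq => // u u'.
  rewrite (sw_comp _ _ (rdual_eval_balanced L u u')).
  rewrite (hopf_dual_antipode_mul _ _ (ldual_copP basis_l f)).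
  by apply: eq_tlift => p q; rewrite tlift_tens //; exact: rdual_eval_balanced.
- move=> f; rewrite /dual_act copr1 tlift_tens; last exact: dual_act_balanced.
  by rewrite mul1r cou_tgtE antipode1.
Qed.

End HopfAlgebroid.

Theorem theorem5p2p4 (k : comPzRingType) (A B H : kalgType k)
    (X : hopf_algebroid A B H)
    (S_bij : bijective (antipode X))
    (fgp_src : fg_projective (src_module (hopf_l X)))
    (fgp_tgt : fg_projective (tgt_module (hopf_l X))) :
  let L := hopf_l X in
  let K := hopf_r_op_coop X in
  exists (Sl : ldual L -> rdual L) (Sr : ldual K -> rdual K)
         (tS_l : ldual K -> ldual L) (tS_r : rdual K -> rdual L),
  [/\ [/\ forall phi h, Sl phi h = dual_antipode L phi h,
          forall phi h, Sr phi h = dual_antipode K phi h,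
          forall phi h, tS_l phi h = phi (antipode X h) &
          forall psi h, tS_r psi h = psi (antipode X h)],
      [/\ is_rbialgebroid_morphism (ldual_bialgebroid L) (rdual_bialgebroid L) Sl id,
          is_rbialgebroid_morphism (ldual_bialgebroid K) (rdual_bialgebroid K) Sr id,
          is_rbialgebroid_morphism (ldual_bialgebroid K) (ldual_bialgebroid L) tS_l id &
          is_rbialgebroid_morphism (rdual_bialgebroid K) (rdual_bialgebroid L) tS_r id] &
      forall phi, Sl (tS_l phi) = tS_r (Sr phi)].
Proof.
move=> L K; have [G SK GK] := S_bij.
have SP : @is_lbialgebroid_morphism _ _ H _ H^c L K (antipode X) id := antipode_lmorphism X.
have GP : @is_lbialgebroid_morphism _ _ H^c _ H K L G id :=
  @lmorphism_inv k A H H^c L K (antipode X) G SK GK SP.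
have lL := fgp_ldual_basis fgp_tgt; have rL := fgp_rdual_basis fgp_src.
have lK := @ldual_basis_transfer k A H H^c L K (antipode X) G GK SP GP lL.
have rK := @rdual_basis_transfer k A H H^c L K (antipode X) G GK SP GP rL.
pose Sl := @hopf_dual_antipode _ _ _ _ X.
pose tS_l := ltranspose SP; pose tS_r := rtranspose SP; pose tG_r := rtranspose GP.
have SlP := hopf_dual_antipode_morphism lL rL.
have tS_lP := ltranspose_morphism SP lL lK.
(* With the conjugate of [Sl] as witness for [S^*_r], its morphism property is inherited from the
   factors; its agreement with [dual_antipode K] is settled at the end. *)
exists Sl, (tG_r \o Sl \o tS_l), tS_l, tS_r; split=> [||phi]; last first.
- by apply: rdualP => h; rewrite -{1}[h]SK.
- split=> //; last exact: rtranspose_morphism.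
  exact: lmorphism_comp tS_lP (lmorphism_comp SlP (rtranspose_morphism GP rK rL)).
split=> // phi h; first exact: hopf_dual_antipodeE.
(* The transport describes [dual_antipode K] at values of the antipode, so [h] is written as the
   antipode of [G h]. *)
rewrite /= -{2}[h]GK.
rewrite (@dual_antipode_transfer k A H H^c L K (antipode X) G GK SP GP
  (can_inj (@galoisK _ _ _ _ X)) phi _ _ (galois_translation X (G h))).
exact: hopf_dual_antipodeE.
Qed.
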